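(* Let $G$ be a finite connected simple graph with at least one edge and $\kappa_{\min}(G)>0$. Put \[ n:=|V(G)|,\qquad \Delta:=\max_{v\in V(G)}d_v,\qquad R:=\left\lfloor\frac{2}{\kappa_{\min}(G)}\right\rfloor . \] Then, for every base vertex $o\in V(G)$, the group $\pi_1(X_{\le 5}(G),o)$ is finite and \[ |\pi_1(X_{\le5}(G),o)|\le\frac{1+\Delta\sum_{j=0}^{R-1}(\Delta-1)^j}{n}, \] where $(\Delta-1)^0$ is interpreted as $1$, also when $\Delta=1$.
   Context: Graphs are undirected and simple; $x\sim y$ denotes adjacency, $d$ is the graph distance, $d_x$ is the degree of $x$. **Short-cycle complex.** For an integer $k\ge3$, $X_{\le k}(G)$ is the two-dimensional CW complex obtained from $G$ (regarded as a one-dimensional CW complex) by attaching one $2$-cell along every simple cycle of $G$ of length at most $k$. $\pi_1$ denotes the ordinary topological fundamental group. **Lin--Lu--Yau curvature.** Let $G=(V,E)$ be a connected locally finite graph. For a vertex $x$ of positive degree and $\alpha\in[0,1]$ let $\mu_x^\alpha$ be the probability measure on $V$ with $\mu_x^\alpha(x)=\alpha$, $\mu_x^\alpha(z)=(1-\alpha)/d_x$ for $z\sim x$, and $\mu_x^\alpha(z)=0$ otherwise. For finitely supported probability measures $\mu,\nu$ on $V$, $W_1(\mu,\nu)=\inf_\pi\sum_{u,v}d(u,v)\pi(u,v)$, the infimum being over all couplings $\pi:V\times V\to[0,\infty)$ of $\mu$ and $\nu$. For distinct $x,y$ put $\kappa_\alpha(x,y)=1-W_1(\mu_x^\alpha,\mu_y^\alpha)/d(x,y)$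 and $\kappa(x,y)=\lim_{\alpha\to1^-}\kappa_\alpha(x,y)/(1-\alpha)$ (the limit is known to exist). For a finite graph with at least one edge, $\kappa_{\min}(G)=\min_{\{x,y\}\in E(G)}\kappa(x,y)$. *)

(* Defs.v *)
From HB Require Import structures.
From mathcomp Require Import all_boot all_order all_algebra.
From mathcomp Require Import generic_quotient finmap ring lra.
From mathcomp Require Import all_classical all_reals all_analysis homotopy.
Import Order.TTheory GRing.Theory Num.Theory.
Import numFieldNormedType.Exports.

Set Implicit Arguments.
Unset Strict Implicit.
Unset Printing Implicit Defensive.

Local Open Scope classical_set_scope.
Local Open Scope ring_scope.
Local Open Scope quotient_scope.

Section unit_interval.
Context {R : realType}.

Definition I01 := set_type (`[0, 1]%classic : set R).

HB.instance Definition _ :=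
  Topological.copy I01 (set_type (`[0, 1]%classic : set R)).

Lemma clamp_subproof (x : R) :
  Num.max 0 (Num.min 1 x) \in (`[0, 1]%classic : set R).
Proof.
by rewrite inE /= in_itv /= le_max lexx /= ge_max ler01 /= ge_min lexx.
Qed.

(* The nearest point of [0, 1]. *)
Definition clamp (x : R) : I01 := SigSub (clamp_subproof x).

Definition ival (t : I01) : R := \val t.

Lemma ival_ge0 t : 0 <= ival t.
Proof.
by case: t => x px; rewrite /ival /=; move: px; rewrite inE /= in_itv /= => /andP[].
Qed.

Lemma ival_le1 t : ival t <= 1.
Proof.
by case: t => x px; rewrite /ival /=; move: px; rewrite inE /= in_itv /= => /andP[].
Qed.

Lemma clampK x : 0 <= x <= 1 -> ival (clamp x) = x.
Proof. by case/andP=> x0 x1; rewrite /ival /= min_r // max_r. Qed.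

Lemma ivalK t : clamp (ival t) = t.
Proof. by apply: val_inj; apply: clampK; rewrite ival_ge0 ival_le1. Qed.

Lemma clamp_lt0 x : x <= 0 -> clamp x = clamp 0.
Proof.
move=> x0; apply: val_inj => /=.
by rewrite !min_r ?ler01 ?maxxx ?max_l // (le_trans x0).
Qed.

Lemma clamp_gt1 x : 1 <= x -> clamp x = clamp 1.
Proof. by move=> x1; apply: val_inj => /=; rewrite !min_l. Qed.

Lemma ival_continuous : continuous ival.
Proof. exact: initial_continuous. Qed.

Lemma clamp_continuous : continuous clamp.
Proof.
apply: continuous_comp_initial => x.
apply: (@continuous_max R R^o (fun=> 0) (fun y => Num.min 1 y)).
  exact: cvg_cst.
by apply: (@continuous_min R R^o (fun=> 1) id); [exact: cvg_cst|exact: cvg_id].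
Qed.

Lemma I01_neq : clamp 0 != clamp 1.
Proof.
apply/eqP => /(congr1 ival) /eqP; rewrite !clampK ?lexx ?ler01 //.
by rewrite eq_sym oner_eq0.
Qed.

HB.instance Definition _ := @isBiPointed.Build I01 (clamp 0) (clamp 1) I01_neq.

End unit_interval.
Arguments I01 : clear implicits.

Section pasting.
Context {R : realType}.

Lemma paste_continuous (X Y : topologicalType) (p : Y -> R) (f g : Y -> X) :
  continuous p -> continuous f -> continuous g ->
  (forall y, p y = 2^-1 -> f y = g y) ->
  continuous (fun y => if p y <= 2^-1 then f y else g y).
Proof.
move=> pc fc gc fg y U; rewrite /=.
have gt_near : 2^-1 < p y -> \forall z \near y, 2^-1 < p z.
  by move=> h; exact: (cvgr_gt (p y) (pc y)).
have lt_near : p y < 2^-1 -> \forall z \near y, p z < 2^-1.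
  by move=> h; exact: (cvgr_lt (p y) (pc y)).
case: (ltgtP (p y) 2^-1) => [py|py|py] UU.
- rewrite /nbhs /=; near=> z; rewrite /=.
  have -> : p z <= 2^-1 by apply: ltW; near: z; exact: lt_near.
  by near: z; exact: fc.
- rewrite /nbhs /=; near=> z; rewrite /=.
  have -> : p z <= 2^-1 = false.
    by apply/negbTE; rewrite -ltNge; near: z; exact: gt_near.
  by near: z; exact: gc.
- rewrite /nbhs /=; near=> z; rewrite /=.
  have Uf : U (f z) by near: z; exact: fc.
  have Ug : U (g z) by near: z; apply: gc; rewrite /= -fg.
  by case: ifP.
Unshelve. all: by end_near.
Qed.

End pasting.


Section continuity.
Context {R : realType}.

Lemma continuous_clamp (Y : topologicalType) (u : Y -> R) :
  continuous u -> continuous (fun y => clamp (u y)).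
Proof. by move=> cu y; apply: continuous_comp; [exact: cu|exact: clamp_continuous]. Qed.

Lemma continuous_ival (Y : topologicalType) (u : Y -> I01 R) :
  continuous u -> continuous (fun y => ival (u y)).
Proof. by move=> cu y; apply: continuous_comp; [exact: cu|exact: ival_continuous]. Qed.

Lemma continuous_pair_map (Y A B : topologicalType) (u : Y -> A) (v : Y -> B) :
  continuous u -> continuous v -> continuous (fun y => (u y, v y)).
Proof. by move=> cu cv y; apply: cvg_pair; [exact: cu|exact: cv]. Qed.

Lemma continuous_comp_fun (Y A B : topologicalType) (f : A -> B) (u : Y -> A) :
  continuous f -> continuous u -> continuous (fun y => f (u y)).
Proof. by move=> cf cu y; apply: continuous_comp; [exact: cu|exact: cf]. Qed.

Lemma continuous_affine (Y : topologicalType) (a b : R) (u : Y -> R) :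
  continuous u -> continuous (fun y => a * u y + b).
Proof.
move=> cu y; apply: cvgD; last exact: cvg_cst.
by apply: cvgM; [exact: cvg_cst|exact: cu].
Qed.

Lemma continuous_interp (Y : topologicalType) (w u v : Y -> R) :
  continuous w -> continuous u -> continuous v ->
  continuous (fun y => (-1 * w y + 1) * u y + w y * v y).
Proof.
move=> cw cu cv y; apply: cvgD; apply: cvgM; [|exact: cu|exact: cw|exact: cv].
exact: continuous_affine.
Qed.

Lemma ival0 : ival (zero : I01 R) = 0.
Proof. by rewrite /zero /= clampK // lexx ler01. Qed.

Lemma ival1 : ival (one : I01 R) = 1.
Proof. by rewrite /one /= clampK // lexx ler01. Qed.

Lemma clamp0 (x : R) : x <= 0 -> clamp x = zero.
Proof. exact: clamp_lt0. Qed.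

Lemma clamp1 (x : R) : 1 <= x -> clamp x = one.
Proof. exact: clamp_gt1. Qed.

End continuity.

Section path_homotopy.
Context {R : realType} {X : topologicalType} (x y : X).

Definition path_homotopic (f g : {path I01 R from x to y}) : Prop :=
  exists H : I01 R * I01 R -> X,
    [/\ continuous H,
        forall s, H (s, zero) = f s,
        forall s, H (s, one) = g s,
        forall t, H (zero, t) = x &
        forall t, H (one, t) = y].

Implicit Types f g h : {path I01 R from x to y}.

Lemma path_homotopic_refl f : path_homotopic f f.
Proof.
exists (fun z => f z.1); split.
- by apply: continuous_comp_fun; [exact: cts_fun|move=> z; exact: cvg_fst].
- by [].
- by [].
- by move=> t /=; rewrite path_zero.
- by move=> t /=; rewrite path_one.
Qed.

Lemma path_homotopic_sym f g : path_homotopic f g -> path_homotopic g f.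
Proof.
case=> H [cH H0 H1 Hx Hy].
exists (fun z => H (z.1, clamp (-1 * ival z.2 + 1))); split.
- apply: continuous_comp_fun => //; apply: continuous_pair_map.
    by move=> z; exact: cvg_fst.
  apply/continuous_clamp/continuous_affine/continuous_ival.
  by move=> z; exact: cvg_snd.
- by move=> s /=; rewrite ival0 clamp1 //; lra.
- by move=> s /=; rewrite ival1 clamp0 //; lra.
- by move=> t /=.
- by move=> t /=.
Qed.

Lemma path_homotopic_trans f g h :
  path_homotopic f g -> path_homotopic g h -> path_homotopic f h.
Proof.
case=> H [cH H0 H1 Hx Hy] [K [cK K0 K1 Kx Ky]].
exists (fun z => if ival z.2 <= 2^-1 then H (z.1, clamp (2 * ival z.2 + 0))
                 else K (z.1, clamp (2 * ival z.2 + -1))).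
have c2 : continuous (fun z : I01 R * I01 R => ival z.2).
  by apply/continuous_ival => z; exact: cvg_snd.
split.
- apply: paste_continuous => //.
  + apply: continuous_comp_fun => //; apply: continuous_pair_map.
      by move=> z; exact: cvg_fst.
    exact/continuous_clamp/continuous_affine.
  + apply: continuous_comp_fun => //; apply: continuous_pair_map.
      by move=> z; exact: cvg_fst.
    exact/continuous_clamp/continuous_affine.
  + by move=> z -> /=; rewrite clamp1 ?clamp0 ?H1 ?K0 //; lra.
- by move=> s /=; rewrite ival0 clamp0 ?H0 ?ifT //; lra.
- by move=> s /=; rewrite ival1 ifF ?clamp1 ?K1 //; [lra|apply/negbTE; lra].
- by move=> t /=; case: ifP.
- by move=> t /=; case: ifP.
Qed.

Lemma path_homotopic_reparam (p : I01 R -> X) (u v : I01 R -> I01 R) f g :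
  continuous p -> continuous u -> continuous v ->
  u zero = v zero -> u one = v one ->
  (forall s, f s = p (u s)) -> (forall s, g s = p (v s)) ->
  path_homotopic f g.
Proof.
move=> cp cu cv uv0 uv1 fE gE.
exists (fun z => p (clamp ((-1 * ival z.2 + 1) * ival (u z.1)
                           + ival z.2 * ival (v z.1)))).
have E t a : (-1 * t + 1) * a + t * a = a :> R by ring.
split.
- apply: continuous_comp_fun => //; apply: continuous_clamp.
  have c1 : continuous (fun z : I01 R * I01 R => z.1) by move=> ?; exact: cvg_fst.
  have c2 : continuous (fun z : I01 R * I01 R => ival z.2).
    by apply/continuous_ival => ?; exact: cvg_snd.
  by apply: continuous_interp => //;
    apply: continuous_ival; exact: continuous_comp_fun.
- by move=> s /=; rewrite ival0 mulr0 add0r mul1r mul0r addr0 ivalK.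
- by move=> s /=; rewrite ival1 mulr1 addNr mul0r add0r mul1r ivalK.
- by move=> t /=; rewrite -uv0 E ivalK -fE path_zero.
- by move=> t /=; rewrite -uv1 E ivalK -fE path_one.
Qed.

End path_homotopy.

Section path_operations.
Context {R : realType} {X : topologicalType}.

Section concat.
Context {x y z : X} (f : {path I01 R from x to y}) (g : {path I01 R from y to z}).

Definition concat_fun (s : I01 R) : X :=
  if ival s <= 2^-1 then f (clamp (2 * ival s + 0))
  else g (clamp (2 * ival s + -1)).

Lemma concat_continuous : continuous concat_fun.
Proof.
have ci : continuous (@ival R) by exact: ival_continuous.
apply: paste_continuous => //.
- apply: continuous_comp_fun; first exact: cts_fun.
  exact/continuous_clamp/continuous_affine.
- apply: continuous_comp_fun; first exact: cts_fun.
  exact/continuous_clamp/continuous_affine.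
- by move=> s -> /=; rewrite clamp1 ?clamp0 ?path_one ?path_zero //; lra.
Qed.

Lemma concat0 : concat_fun zero = x.
Proof. by rewrite /concat_fun ival0 ifT ?clamp0 ?path_zero //; lra. Qed.

Lemma concat1 : concat_fun one = z.
Proof.
by rewrite /concat_fun ival1 ifF ?clamp1 ?path_one //; [lra|apply/negbTE; lra].
Qed.

Definition path_concat : {path I01 R from x to z} :=
  mk_path concat_continuous concat0 concat1.

Lemma path_concatE (s : I01 R) :
  path_concat s = if ival s <= 2^-1 then f (clamp (2 * ival s + 0))
                  else g (clamp (2 * ival s + -1)).
Proof. by []. Qed.

End concat.

Section reverse.
Context {x y : X} (f : {path I01 R from x to y}).

Definition reverse_fun (s : I01 R) : X := f (clamp (-1 * ival s + 1)).

Lemma reverse_continuous : continuous reverse_fun.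
Proof.
apply: continuous_comp_fun; first exact: cts_fun.
exact/continuous_clamp/continuous_affine/ival_continuous.
Qed.

Lemma reverse0 : reverse_fun zero = y.
Proof. by rewrite /reverse_fun ival0 clamp1 ?path_one //; lra. Qed.

Lemma reverse1 : reverse_fun one = x.
Proof. by rewrite /reverse_fun ival1 clamp0 ?path_zero //; lra. Qed.

Definition path_reverse : {path I01 R from y to x} :=
  mk_path reverse_continuous reverse0 reverse1.

Lemma path_reverseE (s : I01 R) : path_reverse s = f (clamp (-1 * ival s + 1)).
Proof. by []. Qed.

End reverse.

Lemma const_continuous (x : X) : continuous (fun _ : I01 R => x).
Proof. exact: cst_continuous. Qed.

Definition path_const (x : X) : {path I01 R from x to x} :=
  mk_path (@const_continuous x) erefl erefl.

Lemma path_homotopic_concat (x y z : X)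
    (f f' : {path I01 R from x to y}) (g g' : {path I01 R from y to z}) :
  path_homotopic f f' -> path_homotopic g g' ->
  path_homotopic (path_concat f g) (path_concat f' g').
Proof.
case=> H [cH H0 H1 Hx Hy] [K [cK K0 K1 Kx Ky]].
exists (fun z => if ival z.1 <= 2^-1 then H (clamp (2 * ival z.1 + 0), z.2)
                 else K (clamp (2 * ival z.1 + -1), z.2)).
have c1 : continuous (fun z : I01 R * I01 R => ival z.1).
  by apply/continuous_ival => ?; exact: cvg_fst.
have c2 : continuous (fun z : I01 R * I01 R => z.2) by move=> ?; exact: cvg_snd.
split.
- apply: paste_continuous => //.
  + apply: continuous_comp_fun => //; apply: continuous_pair_map => //.
    exact/continuous_clamp/continuous_affine.
  + apply: continuous_comp_fun => //; apply: continuous_pair_map => //.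
    exact/continuous_clamp/continuous_affine.
  + by move=> s -> /=; rewrite clamp1 ?clamp0 ?Hy ?Kx //; lra.
- by move=> s /=; rewrite H0 K0.
- by move=> s /=; rewrite H1 K1.
- by move=> t /=; rewrite ival0 ifT ?clamp0 ?Hx //; lra.
- by move=> t /=; rewrite ival1 ifF ?clamp1 ?Ky //; [lra|apply/negbTE; lra].
Qed.

Lemma path_homotopic_reverse (x y : X) (f f' : {path I01 R from x to y}) :
  path_homotopic f f' -> path_homotopic (path_reverse f) (path_reverse f').
Proof.
case=> H [cH H0 H1 Hx Hy].
exists (fun z => H (clamp (-1 * ival z.1 + 1), z.2)); split.
- apply: continuous_comp_fun => //; apply: continuous_pair_map.
    apply/continuous_clamp/continuous_affine/continuous_ival.
    by move=> z; exact: cvg_fst.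
  by move=> z; exact: cvg_snd.
- by move=> s /=; rewrite H0.
- by move=> s /=; rewrite H1.
- by move=> t /=; rewrite ival0 clamp1 //; lra.
- by move=> t /=; rewrite ival1 clamp0 //; lra.
Qed.

Lemma path_concat1p (x y : X) (f : {path I01 R from x to y}) :
  path_homotopic (path_concat (path_const x) f) f.
Proof.
apply: (@path_homotopic_reparam _ _ _ _ f
  (fun s => clamp (2 * ival s + -1)) id) => //.
- exact: cts_fun.
- exact/continuous_clamp/continuous_affine/ival_continuous.
- by move=> ?; exact: cvg_id.
- by rewrite ival0 clamp0 //; lra.
- by rewrite ival1 clamp1 //; lra.
- move=> s; rewrite path_concatE; case: ifP => // hs.
  by rewrite [in RHS]clamp0; [rewrite path_zero|lra].
Qed.

Lemma path_concatp1 (x y : X) (f : {path I01 R from x to y}) :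
  path_homotopic (path_concat f (path_const y)) f.
Proof.
apply: (@path_homotopic_reparam _ _ _ _ f
  (fun s => clamp (2 * ival s + 0)) id) => //.
- exact: cts_fun.
- exact/continuous_clamp/continuous_affine/ival_continuous.
- by move=> ?; exact: cvg_id.
- by rewrite ival0 clamp0 //; lra.
- by rewrite ival1 clamp1 //; lra.
- move=> s; rewrite path_concatE; case: ifP => // hs.
  by rewrite [in RHS]clamp1; [rewrite path_one|move/negbT: hs; lra].
Qed.

Lemma path_concatpV (x y : X) (f : {path I01 R from x to y}) :
  path_homotopic (path_concat f (path_reverse f)) (path_const x).
Proof.
apply: (@path_homotopic_reparam _ _ _ _ f
  (fun s => if ival s <= 2^-1 then clamp (2 * ival s + 0)
            else clamp (-2 * ival s + 2)) (fun=> zero)) => //.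
- exact: cts_fun.
- apply: paste_continuous.
  + exact: ival_continuous.
  + exact/continuous_clamp/continuous_affine/ival_continuous.
  + exact/continuous_clamp/continuous_affine/ival_continuous.
  + by move=> s ->; congr clamp; lra.
- exact: cst_continuous.
- by rewrite ival0 ifT ?clamp0 //; lra.
- by rewrite ival1 ifF; [apply: clamp0; lra|apply/negbTE; lra].
- move=> s; rewrite path_concatE path_reverseE; case: ifP => // hs.
  have s1 := ival_le1 s; move/negbT: hs => hs.
  by rewrite clampK; [congr (f (clamp _)); lra|lra].
- by move=> s; rewrite path_zero.
Qed.

Lemma path_reverseK (x y : X) (f : {path I01 R from x to y}) :
  path_reverse (path_reverse f) = f.
Proof.
apply/path_eqP => s; rewrite !path_reverseE clampK; last by have := ival_ge0 s; have := ival_le1 s; lra.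
by rewrite (_ : -1 * _ + 1 = ival s) ?ivalK //; ring.
Qed.

Lemma path_concatVp (x y : X) (f : {path I01 R from x to y}) :
  path_homotopic (path_concat (path_reverse f) f) (path_const y).
Proof. by have := path_concatpV (path_reverse f); rewrite path_reverseK. Qed.

Lemma path_concatA (x y z w : X) (f : {path I01 R from x to y})
    (g : {path I01 R from y to z}) (h : {path I01 R from z to w}) :
  path_homotopic (path_concat f (path_concat g h))
                 (path_concat (path_concat f g) h).
Proof.
apply/path_homotopic_sym.
pose u (s : I01 R) : I01 R :=
  if ival s <= 2^-1 then
    if 2 * ival s + 0 <= 2^-1 then clamp (2 * ival s + 0)
    else clamp (1 * ival s + 4^-1)
  else clamp (2^-1 * ival s + 2^-1).
have ci := @ival_continuous R.
apply: (@path_homotopic_reparam _ _ _ _ (path_concat f (path_concat g h)) u id)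
  => //.
- exact: cts_fun.
- rewrite /u; apply: paste_continuous => //.
  + apply: paste_continuous.
    * exact: continuous_affine.
    * exact/continuous_clamp/continuous_affine.
    * exact/continuous_clamp/continuous_affine.
    * by move=> s hs; congr clamp; lra.
  + exact/continuous_clamp/continuous_affine.
  + by move=> s ->; rewrite ifF; [congr clamp; lra|apply/negbTE; lra].
- by move=> ?; exact: cvg_id.
- by rewrite /u ival0 ifT ?ifT ?clamp0 //; lra.
- by rewrite /u ival1 ifF ?clamp1 //; [lra|apply/negbTE; lra].
- move=> s; have s0 := ival_ge0 s; have s1 := ival_le1 s.
  rewrite !path_concatE /u.
  case: ifP => [hs|/negbT hs].
    rewrite clampK; last by lra.
    case: ifP => [hs'|/negbT hs'].
      by rewrite clampK ?ifT; [congr (f (clamp _)); lra|lra|lra].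
    rewrite clampK; last by lra.
    rewrite ifF; last by apply/negbTE; lra.
    rewrite clampK; last by lra.
    by rewrite ifT; [congr (g (clamp _)); lra|lra].
  rewrite clampK; last by lra.
  rewrite ifF; last by apply/negbTE; lra.
  rewrite clampK; last by lra.
  rewrite ifF; last by apply/negbTE; lra.
  by congr (h (clamp _)); lra.
Qed.

End path_operations.

Section fundamental_group.
Context {R : realType} {X : topologicalType} (x : X).

Local Notation loop := {path I01 R from x to x}.

Definition loop_homotopic (f g : loop) : bool := `[< path_homotopic f g >].

Lemma loop_homotopic_refl : reflexive loop_homotopic.
Proof. by move=> f; apply/asboolP/path_homotopic_refl. Qed.

Lemma loop_homotopic_sym : symmetric loop_homotopic.
Proof.
by move=> f g; apply/asboolP/asboolP => /path_homotopic_sym.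
Qed.

Lemma loop_homotopic_trans : transitive loop_homotopic.
Proof.
move=> g f h /asboolP fg /asboolP gh; apply/asboolP.
exact: path_homotopic_trans fg gh.
Qed.

Canonical loop_homotopic_equiv :=
  EquivRel loop_homotopic loop_homotopic_refl loop_homotopic_sym
           loop_homotopic_trans.

Definition pi1 : Type := {eq_quot loop_homotopic}.

HB.instance Definition _ := Choice.on pi1.
HB.instance Definition _ := EqQuotient.on pi1.

Lemma pi1_eqP (f g : loop) :
  path_homotopic f g <-> \pi_pi1 f = \pi_pi1 g.
Proof. by split=> [fg|/eqmodP/asboolP//]; apply/eqmodP/asboolP. Qed.

Definition pi1_one : pi1 := \pi_pi1 (path_const x).
Definition pi1_inv (a : pi1) : pi1 := \pi_pi1 (path_reverse (repr a)).
Definition pi1_mul (a b : pi1) : pi1 := \pi_pi1 (path_concat (repr a) (repr b)).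

Lemma repr_pi1 (f : loop) : path_homotopic (repr (\pi_pi1 f)) f.
Proof. by apply/pi1_eqP; rewrite reprK. Qed.

Lemma pi1_mulE (f g : loop) :
  pi1_mul (\pi_pi1 f) (\pi_pi1 g) = \pi_pi1 (path_concat f g).
Proof. by apply/pi1_eqP/path_homotopic_concat; exact: repr_pi1. Qed.

Lemma pi1_invE (f : loop) : pi1_inv (\pi_pi1 f) = \pi_pi1 (path_reverse f).
Proof. by apply/pi1_eqP/path_homotopic_reverse; exact: repr_pi1. Qed.

Lemma pi1_mulA : associative pi1_mul.
Proof.
elim/quotW=> f; elim/quotW=> g; elim/quotW=> h.
by rewrite (pi1_mulE g h) (pi1_mulE f g) !pi1_mulE; apply/pi1_eqP/path_concatA.
Qed.

Lemma pi1_mul1g : left_id pi1_one pi1_mul.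
Proof. by elim/quotW=> f; rewrite pi1_mulE; apply/pi1_eqP/path_concat1p. Qed.

Lemma pi1_mulg1 : right_id pi1_one pi1_mul.
Proof. by elim/quotW=> f; rewrite pi1_mulE; apply/pi1_eqP/path_concatp1. Qed.

Lemma pi1_mulVg : left_inverse pi1_one pi1_inv pi1_mul.
Proof.
by elim/quotW=> f; rewrite pi1_invE pi1_mulE; apply/pi1_eqP/path_concatVp.
Qed.

Lemma pi1_mulgV : right_inverse pi1_one pi1_inv pi1_mul.
Proof.
by elim/quotW=> f; rewrite pi1_invE pi1_mulE; apply/pi1_eqP/path_concatpV.
Qed.

HB.instance Definition _ :=
  isGroup.Build pi1 pi1_mulA pi1_mul1g pi1_mulg1 pi1_mulVg pi1_mulgV.

End fundamental_group.
Arguments pi1 R {X} x.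

Section attach.
Context {Y D : topologicalType} {J : choiceType}.
Context (A : set D) (phi : J -> D -> Y).

Definition attach_summand (i : option J) : topologicalType :=
  if i is Some _ then D else Y.

Definition attach_pre := {i : option J & attach_summand i}.

Definition attach_base (y : Y) : attach_pre := existT attach_summand None y.

Definition attach_cell (j : J) (d : D) : attach_pre :=
  existT attach_summand (Some j) d.

(* Two points are to be identified iff [attach_glue] sends them to the same
   point: a boundary point d of the j-th cell is sent to phi j d, and every
   other point to itself.  The values of phi outside A are irrelevant. *)
Definition attach_glue (p : attach_pre) : attach_pre :=
  match p with
  | existT None y => attach_base y
  | existT (Some j) d =>
      if d \in A then attach_base (phi j d) else attach_cell j d
  end.

Definition attach_rel (p q : attach_pre) : bool :=
  attach_glue p == attach_glue q.

Lemma attach_rel_refl : reflexive attach_rel.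
Proof. by move=> p; exact: eqxx. Qed.

Lemma attach_rel_sym : symmetric attach_rel.
Proof. by move=> p q; exact: eq_sym. Qed.

Lemma attach_rel_trans : transitive attach_rel.
Proof. by move=> q p r /eqP pq /eqP qr; apply/eqP; rewrite pq. Qed.

Canonical attach_equiv :=
  EquivRel attach_rel attach_rel_refl attach_rel_sym attach_rel_trans.

Definition attach : topologicalType :=
  quotient_topology {eq_quot attach_rel}.

Definition attach_pi (p : attach_pre) : attach := \pi_{eq_quot attach_rel} p.

Lemma attach_pi_eqP (p q : attach_pre) :
  attach_pi p = attach_pi q <-> attach_glue p = attach_glue q.
Proof. by split=> [/eqmodP/eqP|pq]; last by apply/eqmodP/eqP. Qed.

Lemma attach_pi_continuous : continuous attach_pi.
Proof. exact: pi_continuous. Qed.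

Lemma attach_boundary (j : J) (d : D) :
  A d -> attach_pi (attach_cell j d) = attach_pi (attach_base (phi j d)).
Proof. by move=> Ad; apply/attach_pi_eqP; rewrite /= mem_set. Qed.

End attach.

Section graph_complex.
Context (R : realType) (V : finType) (e : rel V).

(* One cell per unordered edge {x, y}: the pair whose first component comes
   first in the enumeration of V. *)
Definition is_cell1 : pred (V * V) :=
  [pred p | e p.1 p.2 && (enum_rank p.1 < enum_rank p.2)%N].

Definition cell1 : choiceType := {p : V * V | is_cell1 p}.

Definition boundary1 : set (I01 R) := [set t | t = zero \/ t = one].

Definition attach1 (p : cell1) (t : I01 R) : discrete_topology V :=
  if t == zero then (val p).1 else (val p).2.

Definition graph_space : topologicalType := attach boundary1 attach1.

Definition graph_vertex (x : V) : graph_space :=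
  attach_pi boundary1 attach1 (attach_base (x : discrete_topology V)).

(* The point at proportion t of the edge from x to y, for x adjacent to y
   and 0 <= t <= 1. *)
Definition graph_edge (x y : V) (t : R) : graph_space :=
  if insub (x, y) is Some p
  then attach_pi boundary1 attach1 (attach_cell p (clamp t))
  else if insub (y, x) is Some p
  then attach_pi boundary1 attach1 (attach_cell p (clamp (1 - t)))
  else graph_vertex x.

(* A simple cycle, being neither rooted nor oriented, is listed exactly once:
   from its first vertex in the enumeration of V, and in the direction of the
   earlier of the two neighbours of that vertex on the cycle. *)
Definition is_cell2 (k : nat) : pred (V * seq V) :=
  [pred c | let: (x, s) := c in
    [&& (3 <= size (x :: s) <= k)%N, uniq (x :: s), cycle e (x :: s),
        all (fun y => enum_rank x < enum_rank y)%N s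
      & (enum_rank (head x s) < enum_rank (last x s))%N]].

Definition cell2 (k : nat) : choiceType := {c : V * seq V | is_cell2 k c}.

Definition disk := set_type [set z : R * R | z.1 ^+ 2 + z.2 ^+ 2 <= 1].

HB.instance Definition _ := Topological.copy disk
  (set_type [set z : R * R | z.1 ^+ 2 + z.2 ^+ 2 <= 1]).

Definition boundary2 : set disk :=
  [set d | (\val d).1 ^+ 2 + (\val d).2 ^+ 2 = 1].

(* The t in [0, 1) with z = (cos (2 pi t), sin (2 pi t)), for z on the unit
   circle. *)
Definition turn (z : R * R) : R :=
  xget 0 [set t | 0 <= t < 1 /\ z = (cos (2 * pi * t), sin (2 * pi * t))].

(* The constant-speed closed walk around c, 0 <= t < 1.  When i is the last
   index of x :: s, nth x (x :: s) i.+1 is the default value x. *)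
Definition cycle_walk (c : V * seq V) (t : R) : graph_space :=
  let l := c.1 :: c.2 in
  let u := (size l)%:R * t in
  let i := Num.truncn u in
  graph_edge (nth c.1 l i) (nth c.1 l i.+1) (u - i%:R).

Definition attach2 (k : nat) (c : cell2 k) (d : disk) : graph_space :=
  cycle_walk (val c) (turn (\val d)).

Definition short_cycle_complex (k : nat) : topologicalType :=
  attach boundary2 (@attach2 k).

Definition complex_vertex (k : nat) (x : V) : short_cycle_complex k :=
  attach_pi boundary2 (@attach2 k) (attach_base (graph_vertex x)).

End graph_complex.

Section curvature.
Context (R : realType) (V : finType) (e : rel V).

Definition degree (x : V) : nat := #|[pred y | e x y]|.

Definition max_degree : nat := \max_(x : V) degree x.

Definition has_walk (x y : V) (n : nat) : bool :=
  [exists p : n.-tuple V, path e x p && (last x p == y)].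

(* Least length of a walk from x to y; in a connected graph some walk has
   length less than #|V|. *)
Definition gdist (x y : V) : nat := find (has_walk x y) (iota 0 #|V|).

Definition lazy_measure (a : R) (x z : V) : R :=
  if z == x then a else if e x z then (1 - a) / (degree x)%:R else 0.

Definition coupling (mu nu : V -> R) (c : V -> V -> R) : Prop :=
  [/\ forall u v, 0 <= c u v,
      forall u, \sum_(v : V) c u v = mu u &
      forall v, \sum_(u : V) c u v = nu v].

Definition W1 (mu nu : V -> R) : R :=
  inf [set w : R | exists2 c, coupling mu nu c &
                   w = \sum_(u : V) \sum_(v : V) (gdist u v)%:R * c u v].

Definition kappa_lazy (a : R) (x y : V) : R :=
  1 - W1 (lazy_measure a x) (lazy_measure a y) / (gdist x y)%:R.

(* [lim] is total; the limit always exists for distinct x, y of positive degree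
   in a connected graph. *)
Definition kappa (x y : V) : R :=
  lim ((kappa_lazy a x y / (1 - a)) @[a --> 1^'-]).

(* An infimum over a finite set, nonempty as soon as the graph has an edge:
   the minimum. *)
Definition kappa_min : R :=
  inf [set r : R | exists x y : V, e x y /\ r = kappa x y].

End curvature.

(* Main.v *)
Require Import Defs.
From HB Require Import structures.
From mathcomp Require Import all_boot all_order all_algebra.
From mathcomp Require Import generic_quotient finmap ring lra zify.
From mathcomp Require Import all_classical all_reals all_analysis homotopy.
Import Order.TTheory GRing.Theory Num.Theory.
Import numFieldNormedType.Exports.

(** Identify two edge walks of G from o when they end at the same vertex and
trace homotopic paths in the short-cycle complex.  The classes are the vertices
of a covering graph of G in which closed walks of length at most 5 lift to
closed walks.  The bound compares two estimates of the size of this cover.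

From below: every loop at o is homotopic to a closed edge walk
([complex_path_walk]).  Following it by a fixed walk from o to v attaches a
vertex of the cover to each loop class and each vertex v of G, and different
pairs get different vertices, so the cover has at least |V| |pi_1| of them.  That
loops can be deformed into edge walks is the surjective half of van Kampen's
theorem ([attach_path]); it is used first for the disks glued to the graph, then
for the edges glued to the vertices.

From above: the cover is a ball of radius r = floor(2 / kappa_min) around the class
of the empty walk.  Let f be the distance to this class ([depth]).  If f increases along an edge xy
of the cover, then integrating f against the lazy measures at x and y bounds the
transport cost between them from below, and in the limit
kappa(x, y) <= Lap f(x) - Lap f(y) ([kappa_le], [laplacian_drop]).  The curvature
is that of G: for a neighbour u of x and a neighbour v of y, a distance at most 2
in G closes up a walk of length at most 5, which lifts to the cover by
[complex_walk_short], so f(v) - f(u) is at most this distance; and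
f(v) - f(u) never exceeds 3.  Along a geodesic of length L the inequality
telescopes to L kappa_min <= 2, as Lap f lies between -1 and 1
([geodesic_size]).  Hence each vertex of the cover is reached by a geodesic of
length at most r; it projects to a non-backtracking walk of G, and these walks
are counted by the Moore bound. *)

Set Implicit Arguments.
Unset Strict Implicit.
Unset Printing Implicit Defensive.

Local Open Scope classical_set_scope.
Local Open Scope ring_scope.
Local Open Scope quotient_scope.

(** * Homotopies of paths *)

Section path_functions.
Context {R : realType} {X : topologicalType}.
Local Notation I := (I01 R).
Implicit Types f g h : I -> X.

(** Homotopy relative to the ends, between bare functions: composability is then an
equation between points, which avoids transport of paths along equal end points. *)
Definition homot f g : Prop :=
  exists x y (p q : {path I from x to y}),
    [/\ f = p :> (I -> X), g = q :> (I -> X) & path_homotopic p q].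

Definition pcat f g : I -> X := fun s =>
  if ival s <= 2^-1 then f (clamp (2 * ival s + 0))
  else g (clamp (2 * ival s + -1)).

Definition pback f : I -> X := fun s => f (clamp (-1 * ival s + 1)).

Lemma pcat0 f g : pcat f g zero = f zero.
Proof. by rewrite /pcat ival0 ifT ?clamp0 //; lra. Qed.

Lemma pcat1 f g : pcat f g one = g one.
Proof. by rewrite /pcat ival1 ifF ?clamp1 //; [lra|apply/negbTE; lra]. Qed.

Lemma pback0 f : pback f zero = f one.
Proof. by rewrite /pback ival0 clamp1 //; lra. Qed.

Lemma pback1 f : pback f one = f zero.
Proof. by rewrite /pback ival1 clamp0 //; lra. Qed.

Lemma pcat_cont f g : continuous f -> continuous g -> f one = g zero ->
  continuous (pcat f g).
Proof.
move=> cf cg fg.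
exact: (@concat_continuous _ _ _ _ _ (mk_path cf erefl fg) (mk_path cg erefl erefl)).
Qed.

Lemma pback_cont f : continuous f -> continuous (pback f).
Proof.
by move=> cf; exact: (@reverse_continuous _ _ _ _ (mk_path cf erefl erefl)).
Qed.

Lemma homot_cont f g : homot f g -> continuous f /\ continuous g.
Proof. by move=> [x [y [p [q [-> -> _]]]]]; split; exact: cts_fun. Qed.

Lemma homot_ends f g : homot f g -> f zero = g zero /\ f one = g one.
Proof. by move=> [x [y [p [q [-> -> _]]]]]; rewrite !path_zero !path_one. Qed.

Lemma homot_refl f : continuous f -> homot f f.
Proof.
move=> cf; exists (f zero), (f one), (mk_path cf erefl erefl),
  (mk_path cf erefl erefl); split => //; exact: path_homotopic_refl.
Qed.

Lemma homot_sym f g : homot f g -> homot g f.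
Proof.
move=> [x [y [p [q [-> -> pq]]]]]; exists x, y, q, p.
by split => //; exact: path_homotopic_sym.
Qed.

Lemma homot_trans g f h : homot f g -> homot g h -> homot f h.
Proof.
move=> [x [y [p [q [-> -> pq]]]]] [x' [y' [p' [q' [E -> pq']]]]].
have xE : x = x' by rewrite -(@path_zero _ _ _ _ q) E path_zero.
have yE : y = y' by rewrite -(@path_one _ _ _ _ q) E path_one.
move: p' q' E pq'; rewrite -xE -yE => p' q' E pq'.
exists x, y, p, q'; split => //.
have Eq : q = p' by apply/path_eqP => s; rewrite E.
by rewrite -Eq in pq'; exact: path_homotopic_trans pq pq'.
Qed.

Lemma homot_pcat f f' g g' : homot f f' -> homot g g' -> f one = g zero ->
  homot (pcat f g) (pcat f' g').
Proof.
move=> [x [y [p [q [-> -> pq]]]]] [x' [y' [p' [q' [-> -> pq']]]]].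
rewrite path_one path_zero => yE; move: p' q' pq'; rewrite -yE => p' q' pq'.
exists x, y', (path_concat p p'), (path_concat q q'); split => //.
exact: path_homotopic_concat.
Qed.

Lemma pbackK f : pback (pback f) = f.
Proof.
apply/funext => s; rewrite /pback clampK; last first.
  by have := ival_ge0 s; have := ival_le1 s; lra.
by rewrite (_ : -1 * _ + 1 = ival s) ?ivalK //; ring.
Qed.

Lemma homot_pcatA f g h : continuous f -> continuous g -> continuous h ->
  f one = g zero -> g one = h zero ->
  homot (pcat f (pcat g h)) (pcat (pcat f g) h).
Proof.
move=> cf cg ch fg gh.
pose p := mk_path cf erefl fg; pose q := mk_path cg erefl gh.
pose r := mk_path ch erefl erefl.
exists (f zero), (h one), (path_concat p (path_concat q r)),
  (path_concat (path_concat p q) r); split => //.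
exact: path_concatA.
Qed.

Lemma homot_pcat1p x f : continuous f -> f zero = x -> homot (pcat (fun=> x) f) f.
Proof.
move=> cf fx; pose p := mk_path cf fx erefl.
exists x, (f one), (path_concat (path_const x) p), p; split => //.
exact: path_concat1p.
Qed.

Lemma homot_pcatp1 x f : continuous f -> f one = x -> homot (pcat f (fun=> x)) f.
Proof.
move=> cf fx; pose p := mk_path cf erefl fx.
exists (f zero), x, (path_concat p (path_const x)), p; split => //.
exact: path_concatp1.
Qed.

Lemma homot_pcatpV f : continuous f -> homot (pcat f (pback f)) (fun=> f zero).
Proof.
move=> cf; pose p := mk_path cf erefl erefl.
exists (f zero), (f zero), (path_concat p (path_reverse p)), (path_const (f zero)).
by split => //; exact: path_concatpV.
Qed.

Lemma homot_pcatVp f : continuous f -> homot (pcat (pback f) f) (fun=> f one).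
Proof.
by move=> cf; have := homot_pcatpV (pback_cont cf); rewrite pbackK pback0.
Qed.

Lemma pback_pcat f g : continuous f -> continuous g -> f one = g zero ->
  pback (pcat f g) = pcat (pback g) (pback f).
Proof.
move=> cf cg fg; apply/funext => s; rewrite /pback /pcat.
have s0 := ival_ge0 s; have s1 := ival_le1 s.
have s'E : ival (clamp (-1 * ival s + 1)) = 1 - ival s by rewrite clampK; lra.
rewrite s'E; case: (ltgtP (ival s) 2^-1) => hs.
- rewrite ifF; last by apply/negbTE; lra.
  have -> : ival (clamp (2 * ival s + 0)) = 2 * ival s by rewrite clampK; lra.
  by congr (g (clamp _)); lra.
- rewrite ifT; last by lra.
  have -> : ival (clamp (2 * ival s + -1)) = 2 * ival s - 1.
    by rewrite clampK; lra.
  by congr (f (clamp _)); lra.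
- have -> : ival (clamp (2 * ival s + 0)) = 1 by rewrite clampK; lra.
  rewrite ifT; last lra.
  rewrite (_ : clamp _ = one); last by apply: clamp1; lra.
  by rewrite fg; congr g; apply/esym/clamp0; lra.
Qed.

Lemma cst_cont (x : X) : continuous (fun _ : I => x).
Proof. exact: cst_continuous. Qed.

Lemma pback_cst (x : X) : pback (fun=> x) = (fun=> x).
Proof. by []. Qed.

(** The plane is convex, so that the straight-line homotopy joins any two paths in
it with the same ends.  All reparametrisations and contractions below are images
of this one homotopy. *)
Lemma homot_plane (p : R * R -> X) (u1 u2 v1 v2 : I -> R) :
  continuous p -> continuous u1 -> continuous u2 -> continuous v1 ->
  continuous v2 ->
  u1 zero = v1 zero -> u2 zero = v2 zero -> u1 one = v1 one -> u2 one = v2 one ->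
  homot (fun s => p (u1 s, u2 s)) (fun s => p (v1 s, v2 s)).
Proof.
move=> cp cu1 cu2 cv1 cv2 E01 E02 E11 E12.
have cu : continuous (fun s => p (u1 s, u2 s)).
  by apply: continuous_comp_fun => //; exact: continuous_pair_map.
have cv : continuous (fun s => p (v1 s, v2 s)).
  by apply: continuous_comp_fun => //; exact: continuous_pair_map.
exists (p (u1 zero, u2 zero)), (p (u1 one, u2 one)), (mk_path cu erefl erefl).
have e0 : p (v1 zero, v2 zero) = p (u1 zero, u2 zero) by rewrite E01 E02.
have e1 : p (v1 one, v2 one) = p (u1 one, u2 one) by rewrite E11 E12.
exists (mk_path cv e0 e1); split => //.
exists (fun z => p ((-1 * ival z.2 + 1) * u1 z.1 + ival z.2 * v1 z.1,
                    (-1 * ival z.2 + 1) * u2 z.1 + ival z.2 * v2 z.1)).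
have E t a : (-1 * t + 1) * a + t * a = a :> R by ring.
have c1 : continuous (fun z : I * I => z.1) by move=> ?; exact: cvg_fst.
have c2 : continuous (fun z : I * I => ival z.2).
  by apply/continuous_ival => ?; exact: cvg_snd.
split.
- by apply: continuous_comp_fun => //; apply: continuous_pair_map;
    apply: continuous_interp => //; exact: continuous_comp_fun.
- by move=> s /=; rewrite ival0 !(mulr0, add0r, mul1r, mul0r, addr0).
- by move=> s /=; rewrite ival1 !(mulr1, addNr, mul0r, add0r, mul1r).
- by move=> t /=; rewrite -E01 -E02 !E.
- by move=> t /=; rewrite -E11 -E12 !E.
Qed.

Lemma homot_line (p : R -> X) (u v : I -> R) :
  continuous p -> continuous u -> continuous v ->
  u zero = v zero -> u one = v one ->
  homot (fun s => p (u s)) (fun s => p (v s)).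
Proof.
move=> cp cu cv E0 E1.
apply: (@homot_plane (fun z => p z.1) u (fun=> 0) v (fun=> 0)) => //.
- by apply: continuous_comp_fun => // z; exact: cvg_fst.
- exact: cst_continuous.
- exact: cst_continuous.
Qed.

Lemma homot_square (p : I * I -> X) (u1 u2 v1 v2 : I -> I) :
  continuous p -> continuous u1 -> continuous u2 -> continuous v1 ->
  continuous v2 ->
  u1 zero = v1 zero -> u2 zero = v2 zero -> u1 one = v1 one -> u2 one = v2 one ->
  homot (fun s => p (u1 s, u2 s)) (fun s => p (v1 s, v2 s)).
Proof.
move=> cp cu1 cu2 cv1 cv2 E01 E02 E11 E12.
have := @homot_plane (fun z => p (clamp z.1, clamp z.2))
  (fun s => ival (u1 s)) (fun s => ival (u2 s))
  (fun s => ival (v1 s)) (fun s => ival (v2 s)).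
rewrite /= (_ : (fun s => p _) = fun s => p (u1 s, u2 s)); last first.
  by apply/funext => s; rewrite !ivalK.
rewrite (_ : (fun s => p (clamp (ival (v1 s)), _)) = fun s => p (v1 s, v2 s)); last first.
  by apply/funext => s; rewrite !ivalK.
apply; rewrite ?E01 ?E02 ?E11 ?E12 //; try exact: continuous_ival.
apply: continuous_comp_fun => //; apply: continuous_pair_map;
  apply: continuous_clamp => z; [exact: cvg_fst|exact: cvg_snd].
Qed.

End path_functions.

Lemma pcat_comp (R : realType) (X Y : topologicalType) (m : X -> Y)
    (f g : I01 R -> X) : m \o pcat f g = pcat (m \o f) (m \o g).
Proof. by apply/funext => s; rewrite /pcat /=; case: ifP. Qed.

Lemma pback_comp (R : realType) (X Y : topologicalType) (m : X -> Y)
    (f : I01 R -> X) : m \o pback f = pback (m \o f).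
Proof. by []. Qed.

Lemma comp_cont (X Y Z : topologicalType) (m : Y -> Z) (f : X -> Y) :
  continuous m -> continuous f -> continuous (m \o f).
Proof. by move=> cm cf; exact: continuous_comp_fun. Qed.

Lemma homot_comp (R : realType) (X Y : topologicalType) (m : X -> Y)
    (f g : I01 R -> X) : continuous m -> homot f g -> homot (m \o f) (m \o g).
Proof.
move=> cm [x [y [p [q [-> -> [H [cH H0 H1 Hx Hy]]]]]]].
have cp : continuous (m \o p) by apply: comp_cont => //; exact: cts_fun.
have cq : continuous (m \o q) by apply: comp_cont => //; exact: cts_fun.
have p0 : (m \o p) zero = m x by rewrite /= path_zero.
have p1 : (m \o p) one = m y by rewrite /= path_one.
have q0 : (m \o q) zero = m x by rewrite /= path_zero.
have q1 : (m \o q) one = m y by rewrite /= path_one.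
exists (m x), (m y), (mk_path cp p0 p1), (mk_path cq q0 q1); split => //.
exists (m \o H); split => /=; first exact: comp_cont.
- by move=> s; rewrite H0.
- by move=> s; rewrite H1.
- by move=> t; rewrite Hx.
- by move=> t; rewrite Hy.
Qed.

(** * Paths in a space with attached cells *)

Lemma compact_I01 (R : realType) : compact [set: I01 R].
Proof.
rewrite (_ : setT = clamp @` `[0, 1]%classic).
  apply: continuous_compact; last exact: segment_compact.
  exact/continuous_subspaceT/clamp_continuous.
apply/seteqP; split=> // t _; exists (ival t); last exact: ivalK.
by rewrite /= in_itv /= ival_ge0 ival_le1.
Qed.

Section attach_topology.
Context {Y D : topologicalType} {J : choiceType}.
Context (A : set D) (phi : J -> D -> Y).

Definition base_pt (y : Y) : attach A phi := attach_pi A phi (attach_base y).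
Definition cell_pt (j : J) (d : D) : attach A phi :=
  attach_pi A phi (attach_cell j d).

(** The normal form of a point: the representative of its class that is not on the
boundary of a cell. *)
Definition attach_out (p : attach A phi) : @attach_pre Y D J :=
  attach_glue A phi (repr p).

Lemma attach_outE (p : @attach_pre Y D J) :
  attach_out (attach_pi A phi p) = attach_glue A phi p.
Proof. by apply/attach_pi_eqP; rewrite /attach_pi reprK. Qed.

Lemma attach_out_base y : attach_out (base_pt y) = attach_base y.
Proof. exact: attach_outE. Qed.

Lemma attach_out_cell j d : ~ A d -> attach_out (cell_pt j d) = attach_cell j d.
Proof. by move=> Ad; rewrite attach_outE /= memNset. Qed.

Lemma cell_pt_boundary j d : A d -> cell_pt j d = base_pt (phi j d).
Proof. exact: attach_boundary. Qed.

Lemma base_pt_inj : injective base_pt.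
Proof.
move=> y y' /(congr1 attach_out); rewrite !attach_out_base; exact: existT_inj2.
Qed.

Lemma attach_case (p : attach A phi) :
  (exists y, p = base_pt y) \/ exists j d, ~ A d /\ p = cell_pt j d.
Proof.
rewrite -[p]reprK; case: (repr p) => -[j|] d; last by left; exists d.
have [Ad|Ad] := pselect (A d).
  by left; exists (phi j d); exact: cell_pt_boundary.
by right; exists j, d.
Qed.

Lemma attach_openP (U : set (attach A phi)) :
  open U <-> open (base_pt @^-1` U) /\ forall j, open (cell_pt j @^-1` U).
Proof.
split=> [oU|[oY oD]].
  have : open (attach_pi A phi @^-1` U) by exact: oU.
  move/sigT_openP => oU'; split=> [|j]; [exact: (oU' None)|exact: (oU' (Some j))].
suff : open (attach_pi A phi @^-1` U) by [].
by apply/sigT_openP => -[j|]; [exact: oD|exact: oY].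
Qed.

Lemma base_pt_continuous : continuous base_pt.
Proof. by apply/continuousP => U /attach_openP[]. Qed.

Lemma cell_pt_continuous j : continuous (cell_pt j).
Proof. by apply/continuousP => U /attach_openP[_ /(_ j)]. Qed.

End attach_topology.

Section attach_paths.
Context {R : realType} {Y D : topologicalType} {J : choiceType}.
Local Notation I := (I01 R).
Context (A : set D) (phi : J -> D -> Y).
Local Notation X := (attach A phi).
Local Notation base := (@base_pt Y D J A phi).
Local Notation cell := (@cell_pt Y D J A phi).
(** A cell is a space D with boundary A that slides to A along F away from its centre
c, and each point of which is joined in D to the boundary point b. *)
Context (c : D) (F : D * I -> D).
Context (closedA : closed A) (Ac : ~ A c) (closedc : closed [set c])
  (F_cont : forall d t, d <> c -> {for (d, t), continuous F})
  (F_start : forall d, F (d, zero) = d)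
  (F_end : forall d, d <> c -> A (F (d, one)))
  (F_fix : forall a t, A a -> F (a, t) = a)
  (phiF : forall j d, d <> c -> {for d, continuous (fun d => phi j (F (d, one)))})
  (b : D) (Ab : A b)
  (ray : forall d, exists u : I -> D, [/\ continuous u, u zero = b & u one = d]).

(** Removing the centres of the cells leaves an open set that retracts onto the
base. *)
Definition punctured : set X := [set p | forall j, p <> cell j c].

(** [F] pushes a punctured cell towards its boundary and fixes the boundary, so it
extends by the identity of the base. *)
Definition slide (z : X * I) : X :=
  match attach_out z.1 with
  | existT None y => base y
  | existT (Some j) d => cell j (F (d, z.2))
  end.

(** The end of the sliding motion, as a point of Y; the value [y0] at the removed
centres makes it total. *)
Definition push (y0 : Y) (p : X) : Y :=
  match attach_out p with
  | existT None y => y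
  | existT (Some j) d => if d == c then y0 else phi j (F (d, one))
  end.

Lemma cell_out j d : attach_out (cell j d) =
  if d \in A then @attach_base Y D J (phi j d) else attach_cell j d.
Proof. exact: attach_outE. Qed.

Lemma slide_base y t : slide (base y, t) = base y.
Proof. by rewrite /slide /= attach_out_base. Qed.

Lemma slide_cell j d t : slide (cell j d, t) = cell j (F (d, t)).
Proof.
rewrite /slide /= cell_out; case: ifPn => //= /set_mem Ad.
by rewrite F_fix // cell_pt_boundary.
Qed.

Lemma push_base y0 y : push y0 (base y) = y.
Proof. by rewrite /push attach_out_base. Qed.

Lemma push_cell y0 j d : d <> c -> push y0 (cell j d) = phi j (F (d, one)).
Proof.
move=> dc; rewrite /push cell_out; case: ifPn => /= [/set_mem Ad|_].
  by rewrite F_fix.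
by rewrite (introF eqP dc).
Qed.

Lemma cell_punctured j d : punctured (cell j d) <-> d <> c.
Proof.
split=> [/(_ j) E dc|dc k E]; first by rewrite dc in E.
have := congr1 (@attach_out _ _ _ _ _) E; rewrite !cell_out (memNset Ac).
case: ifP => // _ E'; apply: dc.
have jk : j = k by have := congr1 (@tag _ _) E' => -[].
by rewrite jk in E'; have := existT_inj2 E'.
Qed.

Lemma base_punctured y : punctured (base y).
Proof.
move=> j /(congr1 (@attach_out _ _ _ _ _)).
by rewrite cell_out attach_out_base (memNset Ac).
Qed.

Lemma open_punctured : open punctured.
Proof.
apply/attach_openP; split=> [|j].
  rewrite (_ : _ @^-1` _ = setT); first exact: openT.
  by apply/seteqP; split=> // y _; exact: base_punctured.
rewrite (_ : _ @^-1` _ = ~` [set c]); first exact: closed_openC.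
by apply/seteqP; split=> d; move/(cell_punctured j d).
Qed.

Lemma open_cell_image j (Q : set D) : open Q -> Q `<=` ~` A ->
  open (cell j @` Q).
Proof.
move=> oO OA; apply/attach_openP; split=> [|k].
  rewrite (_ : _ @^-1` _ = set0); first exact: open0.
  apply/seteqP; split=> // y [d Od] /(congr1 (@attach_out _ _ _ _ _)).
  by rewrite attach_out_base attach_out_cell //; exact: OA.
have [<-|jk] := eqVneq j k.
  rewrite (_ : _ @^-1` _ = Q) //; apply/seteqP; split=> d; last by exists d.
  move=> [d' Od'] /(congr1 (@attach_out _ _ _ _ _)).
  rewrite attach_out_cell; last exact: OA.
  rewrite cell_out; case: ifP => // _ E.
  by have <- : d' = d := existT_inj2 E.
rewrite (_ : _ @^-1` _ = set0); first exact: open0.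
apply/seteqP; split=> // d [d' Od'] /(congr1 (@attach_out _ _ _ _ _)).
rewrite attach_out_cell; last exact: OA.
rewrite cell_out; case: ifP => // _ /(congr1 (@tag _ _)) [] /eqP.
by rewrite (negbTE jk).
Qed.

Lemma push_continuous y0 p : punctured p -> {for p, continuous (push y0)}.
Proof.
move=> Wp U; rewrite /= nbhsE /= => -[V [oV Vp] VU].
suff : nbhs p (punctured `&` push y0 @^-1` V).
  by apply: filterS => q [_ /VU].
apply: open_nbhs_nbhs; split=> //; apply/attach_openP; split=> [|j].
  rewrite (_ : _ @^-1` _ = V) //; apply/seteqP; split=> y.
    by move=> [_]; rewrite /= push_base.
  by move=> Vy; split; [exact: base_punctured|rewrite /= push_base].
rewrite openE => d [dc0] /=; have dc := iffLR (cell_punctured j d) dc0.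
rewrite push_cell // => Vd.
have : \forall d' \near d, d' <> c.
  have : open (~` [set c]) by exact: closed_openC.
  by rewrite openE; apply.
have : \forall d' \near d, V (phi j (F (d', one))).
  by have /(_ V) := @phiF j d dc; apply; apply: open_nbhs_nbhs.
apply: filterS2 => d' Vd' d'c; split; first exact/cell_punctured.
by rewrite /= push_cell.
Qed.

(** At a point of the base, which does not move, compactness of the interval gives a
neighbourhood whose whole track stays in a prescribed open set.  This is where
one would otherwise use that the product of a quotient map with the interval is
a quotient map. *)
Lemma slide_continuous p t : punctured p -> {for (p, t), continuous slide}.
Proof.
move=> Wp U nU.
have [V [oV Vp] VU] : exists2 V, open_nbhs (slide (p, t)) V & V `<=` U.
  by have : nbhs (slide (p, t)) U by []; rewrite nbhsE.
suff : nbhs (p, t) (slide @^-1` V) by apply: filterS => z; exact: VU.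
move/attach_openP : (oV) => [oVY oVD].
have [[y E]|[j [d [Ad E]]]] := attach_case p.
  rewrite {}E slide_base in Wp Vp *.
  pose N := [set q | punctured q /\ forall t, V (slide (q, t))].
  suff oN : open N.
    have nN : nbhs (base y) N.
      apply: open_nbhs_nbhs; split=> //; split=> [|s]; first exact: base_punctured.
      by rewrite slide_base.
    exists (N, setT) => /=; last by move=> [q s] [/= [_ Nq] _]; exact: Nq.
    by split=> //; exact: filterT.
  apply/attach_openP; split=> [|j].
    rewrite (_ : _ @^-1` _ = base @^-1` V) //; apply/seteqP; split=> y'.
      by move=> [_ /(_ zero)]; rewrite /= slide_base.
    by move=> Vy; split=> [|s]; [exact: base_punctured|rewrite /= slide_base].
  rewrite openE => d [dc0 Vd]; have dc := iffLR (cell_punctured j d) dc0.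
  have nc : \forall d' \near d, d' <> c.
    have : open (~` [set c]) by exact: closed_openC.
    by rewrite openE; apply.
  have : \forall d' \near d, forall s, setT s -> V (cell j (F (d', s))).
    have near_cov : near_covering [set: I].
      exact/compact_near_coveringP/compact_I01.
    apply: (near_cov D (nbhs d) (fun d' s => V (cell j (F (d', s)))) _ _) => s _.
    have [[Q T] [/= nQ nT] OT] : nbhs (d, s) (F @^-1` (cell j @^-1` V)).
      have /(_ (cell j @^-1` V)) := @F_cont d s dc; apply.
      apply: open_nbhs_nbhs; split => //=.
      by have := Vd s; rewrite slide_cell.
    by exists (T, Q) => // -[s' d'] [/= Ts' Od']; exact: (OT (d', s')).
  apply: filterS2 nc => d' d'c Vd'; split; first exact/cell_punctured.
  by move=> s; rewrite /= slide_cell; exact: Vd'.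
rewrite {}E slide_cell in Wp Vp *.
move/cell_punctured : Wp => dc.
have : nbhs (d, t) (F @^-1` (cell j @^-1` V)).
  have /(_ (cell j @^-1` V)) := @F_cont d t dc; apply.
  exact: open_nbhs_nbhs.
move=> [[Q T] [/= nQ nT] OT].
have [Q' oQ' Q'Q] : exists2 Q', open_nbhs d Q' & Q' `<=` Q.
  by move: nQ; rewrite nbhsE.
have nQ' : nbhs (cell j d) (cell j @` (Q' `&` ~` A)).
  apply: open_nbhs_nbhs; split; last by exists d => //; case: oQ'.
  apply: open_cell_image; last by move=> x [].
  by apply: openI; [case: oQ'|exact: closed_openC].
exists (cell j @` (Q' `&` ~` A), T) => //=.
move=> [q s] [/= [d' [Q'd' _] <-] Ts].
by rewrite slide_cell; apply: (OT (d', s)); split => //; exact: Q'Q.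
Qed.

Context (K : (I -> X) -> Prop)
  (K_hom : forall f g, homot f g -> K g -> K f)
  (K_cat : forall f g, K f -> K g -> f one = g zero -> K (pcat f g))
  (K_base : forall u : I -> Y, continuous u -> K (base \o u))
  (K_cell : forall j (u : I -> D), continuous u -> A (u zero) -> A (u one) ->
     K (cell j \o u)).

(** A path from the base to [p] that is trivial when [p] is in the base and stays in
any closed cell containing [p]; these paths play the role of a maximal tree. *)
Definition access (p : X) (f : I -> X) : Prop :=
  [/\ continuous f, f one = p, (exists y, f zero = base y),
      (forall y, p = base y -> f = fun=> p) &
      forall j d, p = cell j d -> exists u : I -> D,
        [/\ continuous u, A (u zero), u one = d & f = cell j \o u]].

Lemma access_exists p : exists f, access p f.
Proof.
have [[y ->]|[j [d [Ad ->]]]] := attach_case p.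
  exists (fun=> base y); split=> //; first exact: cst_cont.
    by exists y.
  move=> j d E; exists (fun=> d); split=> //; first exact: cst_cont.
    apply: contrapT => Ad; move/(congr1 (@attach_out _ _ _ _ _)): E.
    by rewrite attach_out_base attach_out_cell.
  by rewrite E.
have [u [cu u0 u1]] := ray d.
exists (cell j \o u); split.
- by apply: comp_cont => //; exact: cell_pt_continuous.
- by rewrite /= u1.
- by exists (phi j b); rewrite /= u0 cell_pt_boundary.
- move=> y /(congr1 (@attach_out _ _ _ _ _)).
  by rewrite attach_out_base attach_out_cell.
- move=> j' d' /(congr1 (@attach_out _ _ _ _ _)).
  rewrite attach_out_cell // cell_out; case: ifP => // _ E.
  have jj : j = j' by have := congr1 (@tag _ _) E => -[].
  rewrite -{}jj in E *; have dd : d = d' := existT_inj2 E.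
  by exists u; split => //; rewrite ?u0 // -dd.
Qed.

Definition acc (p : X) : I -> X := projT1 (cid (access_exists p)).

Lemma accP p : access p (acc p).
Proof. exact: projT2 (cid (access_exists p)). Qed.

Lemma acc_cont p : continuous (acc p). Proof. by case: (accP p). Qed.

Lemma acc1 p : acc p one = p. Proof. by case: (accP p). Qed.

Lemma acc_base y : acc (base y) = fun=> base y.
Proof. by case: (accP (base y)) => _ _ _ /(_ y erefl). Qed.

Lemma acc_cell j d : exists u : I -> D,
  [/\ continuous u, A (u zero), u one = d & acc (cell j d) = cell j \o u].
Proof. by case: (accP (cell j d)) => _ _ _ _ /(_ j d erefl). Qed.

(** A path between arbitrary points is tested after it has been closed up by access
paths, as [K] only speaks of paths between points of the base. *)
Definition good (f : I -> X) : Prop :=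
  K (pcat (acc (f zero)) (pcat f (pback (acc (f one))))).

Lemma good_hom f g : homot f g -> good g -> good f.
Proof.
move=> fg; rewrite /good; have [-> ->] := homot_ends fg.
apply: K_hom; have [cf cg] := homot_cont fg; have [f0 f1] := homot_ends fg.
apply: homot_pcat; [exact/homot_refl/acc_cont| |by rewrite pcat0 acc1].
by apply: homot_pcat => //; [exact/homot_refl/pback_cont/acc_cont|rewrite pback0 acc1].
Qed.

(** The access path to the middle point is run back and forth, and cancels. *)
Lemma good_cat f g : continuous f -> continuous g -> f one = g zero ->
  good f -> good g -> good (pcat f g).
Proof.
move=> cf cg fg; rewrite /good pcat0 pcat1 fg.
set a := acc _; set m := acc _; set n := acc _ => Kf Kg.
have [ca a1] : continuous a /\ a one = f zero.
  by split; [exact: acc_cont|exact: acc1].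
have [cm m1] : continuous m /\ m one = g zero.
  by split; [exact: acc_cont|exact: acc1].
have [cn n1] : continuous n /\ n one = g one.
  by split; [exact: acc_cont|exact: acc1].
have cgn : continuous (pcat g (pback n)).
  by apply: pcat_cont => //; [exact: pback_cont|rewrite pback0].
have cmr : continuous (pback m) by exact: pback_cont.
have cfm : continuous (pcat f (pback m)) by apply: pcat_cont => //; rewrite pback0 m1.
have cmgn : continuous (pcat m (pcat g (pback n))) by apply: pcat_cont; rewrite ?pcat0.
apply: (K_hom _ (K_cat Kf Kg _)); last by rewrite !pcat1 pcat0 pback1.
apply: (@homot_trans _ _ (pcat a (pcat (pcat f (pback m)) (pcat m (pcat g (pback n)))))); last first.
  by apply: homot_pcatA => //; rewrite ?pcat0 ?pcat1 ?pback1.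
apply: homot_pcat; [exact: homot_refl| |by rewrite !pcat0].
apply: (@homot_trans _ _ (pcat f (pcat g (pback n)))).
  by apply/homot_sym/homot_pcatA => //; [exact: pback_cont|rewrite pback0].
apply: (@homot_trans _ _ (pcat f (pcat (pback m) (pcat m (pcat g (pback n)))))); last first.
  by apply: homot_pcatA => //; rewrite ?pcat0 ?pback0 ?pback1 ?m1.
apply: homot_pcat; [exact: homot_refl| |by rewrite pcat0].
apply: (@homot_trans _ _ (pcat (pcat (pback m) m) (pcat g (pback n)))); last first.
  by apply/homot_sym/homot_pcatA => //; rewrite ?pcat0 ?pback1.
apply: homot_sym; apply: (@homot_trans _ _ (pcat (fun=> m one) (pcat g (pback n)))).
  by apply: homot_pcat; [exact: homot_pcatVp|exact: homot_refl|rewrite pcat0 pcat1].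
by apply: homot_pcat1p => //; rewrite pcat0.
Qed.

Lemma good_base (u : I -> Y) : continuous u -> good (base \o u).
Proof.
move=> cu; have cbu : continuous (base \o u).
  by apply: comp_cont => //; exact: base_pt_continuous.
rewrite /good /= !acc_base pback_cst; apply: K_hom (K_base cu).
have cu' : continuous (pcat (base \o u) (fun=> base (u one))).
  by apply: pcat_cont => //; exact: cst_cont.
apply: (@homot_trans _ _ (pcat (base \o u) (fun=> base (u one)))).
  by apply: homot_pcat1p; rewrite ?pcat0.
exact: homot_pcatp1.
Qed.

(** Access paths to points of a cell stay in it, so that closing up gives a path in
the cell between boundary points. *)
Lemma good_cell j (u : I -> D) : continuous u -> good (cell j \o u).
Proof.
move=> cu; rewrite /good /=.
have [v [cv v0 v1 ->]] := acc_cell j (u zero).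
have [w [cw w0 w1 ->]] := acc_cell j (u one).
rewrite -pback_comp -!pcat_comp; apply: K_cell; rewrite ?pcat0 ?pcat1 ?pback1 //.
apply: pcat_cont => //; last by rewrite pcat0.
by apply: pcat_cont => //; [exact: pback_cont|rewrite pback0].
Qed.

Lemma slide_start p : slide (p, zero) = p.
Proof.
have [[y ->]|[j [d [_ ->]]]] := attach_case p; first exact: slide_base.
by rewrite slide_cell F_start.
Qed.

Lemma slide_end y0 p : punctured p -> slide (p, one) = base (push y0 p).
Proof.
have [[y ->] _|[j [d [_ ->]]] /cell_punctured dc] := attach_case p.
  by rewrite slide_base push_base.
by rewrite slide_cell push_cell // cell_pt_boundary //; exact: F_end.
Qed.

Lemma slide_track_cont p : punctured p -> continuous (fun t => slide (p, t)).
Proof.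
move=> Wp t; apply: (@continuous_comp _ _ _ (fun t => (p, t)) slide).
  by apply: continuous_pair_map; [exact: cst_cont|move=> ?; exact: cvg_id].
exact: slide_continuous.
Qed.

Lemma good_track p : punctured p ->
  good (fun t => slide (p, t)) /\ good (pback (fun t => slide (p, t))).
Proof.
have [[y ->] _|[j [d [_ ->]]] /cell_punctured dc] := attach_case p.
  rewrite (_ : (fun _ => _) = base \o fun=> y).
    by split; [|rewrite -pback_comp]; apply: good_base; exact: cst_cont.
  by apply/funext => t; rewrite slide_base.
rewrite (_ : (fun _ => _) = cell j \o fun t => F (d, t)); last first.
  by apply/funext => t; rewrite slide_cell.
have cF : continuous (fun t => F (d, t)).
  move=> t; apply: (@continuous_comp _ _ _ (fun t => (d, t)) F).
    by apply: continuous_pair_map; [exact: cst_cont|move=> ?; exact: cvg_id].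
  exact: F_cont.
by split; [|rewrite -pback_comp]; apply: good_cell => //; exact: pback_cont.
Qed.

(** Sliding the path to the base decomposes it into the track of its origin, a path
in the base, and the track of its end run backwards. *)
Lemma good_punctured (f : I -> X) : continuous f ->
  (forall s, punctured (f s)) -> good f.
Proof.
move=> cf Wf.
have [y0 _] : exists y0 : Y, True.
  by have [[y _]|[j [d _]]] := attach_case (f zero); [exists y|exists (phi j d)].
pose H (z : I * I) := slide (f z.1, z.2).
have cH : continuous H.
  move=> z; apply: (@continuous_comp _ _ _ (fun z => (f z.1, z.2)) slide).
    apply: continuous_pair_map; last by move=> ?; exact: cvg_snd.
    by apply: continuous_comp_fun => // ?; exact: cvg_fst.
  exact: slide_continuous.
have cid' : continuous (fun s : I => s) by move=> ?; exact: cvg_id.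
pose t0 := fun t => slide (f zero, t); pose t1 := fun t => slide (f one, t).
pose top := base \o (push y0 \o f).
have cpf : continuous (push y0 \o f).
  move=> s; apply: continuous_comp; first exact: cf.
  exact: push_continuous.
have ctop : continuous top.
  by apply: comp_cont => //; exact: base_pt_continuous.
have ct1 := slide_track_cont (Wf one); have ct0 := slide_track_cont (Wf zero).
have topE s : slide (f s, one) = top s by rewrite (slide_end y0).
have E1 : top one = pback t1 zero by rewrite pback0 -topE.
have E0 : t0 one = pcat top (pback t1) zero by rewrite pcat0 -topE.
have ctt : continuous (pcat top (pback t1)).
  by apply: pcat_cont => //; exact: pback_cont.
have [g0 _] := good_track (Wf zero); have [_ g1] := good_track (Wf one).
apply: (@good_hom _ (pcat t0 (pcat top (pback t1)))); last first.
  apply: good_cat => //; apply: good_cat => //; first exact: pback_cont.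
  exact: good_base.
have := @homot_square _ _ H (fun s => s) (fun=> zero)
  (pcat (fun=> zero) (pcat (fun s => s) (fun=> one)))
  (pcat (fun s => s) (pcat (fun=> one) (pback (fun s => s)))).
rewrite (_ : (fun s => H (s, zero)) = f); last first.
  by apply/funext => s; rewrite /H slide_start.
rewrite (_ : (fun s => H _) = pcat t0 (pcat top (pback t1))); last first.
  apply/funext => s; rewrite /pcat /H /t0 /t1; case: ifP => //= _.
  by case: ifP => //= _; rewrite topE.
apply => //.
- exact: cst_cont.
- apply: pcat_cont; [exact: cst_cont| |by rewrite pcat0].
  by apply: pcat_cont => //; exact: cst_cont.
- apply: pcat_cont => //; last by rewrite pcat0.
  by apply: pcat_cont; [exact: cst_cont|exact: pback_cont|rewrite pback0].
- by rewrite pcat0.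
- by rewrite pcat0.
- by rewrite !pcat1.
- by rewrite !pcat1 pback1.
Qed.

(** The complement of the boundary in D maps homeomorphically to an open set of the
space, so the path lifts to D. *)
Lemma good_open_cell j (f : I -> X) : continuous f ->
  (forall s, (cell j @` ~` A) (f s)) -> good f.
Proof.
move=> cf fA.
have /(@choice _ _ (fun s d => ~ A d /\ cell j d = f s))[u uP] :
    forall s, exists d, ~ A d /\ cell j d = f s.
  by move=> s; have [d Ad E] := fA s; exists d.
have Au s : ~ A (u s) by case: (uP s).
have uE s : cell j (u s) = f s by case: (uP s).
rewrite (_ : f = cell j \o u); last by apply/funext => s; rewrite /= uE.
apply: good_cell; apply/continuousP => Q oQ.
rewrite (_ : _ @^-1` _ = f @^-1` (cell j @` (Q `&` ~` A))); last first.
  apply/seteqP; split=> s /=.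
    by move=> Qs; exists (u s) => //; split => //; exact: Au.
  move=> [d [Qd Ad]]; rewrite -uE => /(congr1 (@attach_out _ _ _ _ _)).
  rewrite !attach_out_cell // => E.
  by have <- : d = u s := existT_inj2 E.
move/continuousP: cf; apply; apply: open_cell_image; last by move=> x [].
by apply: openI => //; exact: closed_openC.
Qed.

Lemma good_local p : exists2 W : set X, open_nbhs p W &
  forall f : I -> X, continuous f -> (forall s, W (f s)) -> good f.
Proof.
have [[y ->]|[j [d [Ad ->]]]] := attach_case p.
  exists punctured; last by move=> f; exact: good_punctured.
  by split; [exact: open_punctured|exact: base_punctured].
exists (cell j @` ~` A); last by move=> f; exact: good_open_cell.
split; last by exists d.
by apply: open_cell_image => //; exact: closed_openC.
Qed.

(** Being good is a locally constant property of the portion of [f] up to time t, and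
the line is connected. *)
Lemma good_all (f : I -> X) : continuous f -> good f.
Proof.
move=> cf; pose g (t : R) := f (clamp t).
have cg : continuous g.
  by apply: continuous_comp_fun => //; exact: clamp_continuous.
pose lin a a' (s : I) : R := (-1 * ival s + 1) * a + ival s * a'.
have clin a a' : continuous (lin a a').
  apply: continuous_interp; [exact: ival_continuous|exact: cst_continuous..].
have lin0 a a' : lin a a' zero = a by rewrite /lin ival0; lra.
have lin1 a a' : lin a a' one = a' by rewrite /lin ival1; lra.
have cseg a a' : continuous (g \o lin a a') by exact: comp_cont.
have near_good (t : R) :
    \forall t' \near t, good (g \o lin t t') /\ good (g \o lin t' t).
  have [W nW gW] := good_local (g t).
  have /nbhs_ballP[r /= r0 rW] : nbhs t (g @^-1` W).
    by apply: cg; apply: open_nbhs_nbhs.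
  apply/nbhs_ballP; exists r => //= t' tt'.
  rewrite /ball /= in tt'.
  have bd (s : I) : `|(1 - ival s) * (t - t')| < r /\ `|ival s * (t - t')| < r.
    have s0 := ival_ge0 s; have s1 := ival_le1 s.
    have n0 := normr_ge0 (t - t').
    rewrite !normrM (ger0_norm s0) (@ger0_norm _ (1 - _)); last by lra.
    by split; apply: le_lt_trans tt'; rewrite ler_piMl //; lra.
  split; apply: gW => // s; apply: rW; rewrite /ball /=; have [b1 b2] := bd s.
    by rewrite (_ : t - _ = ival s * (t - t')) // /lin; ring.
  by rewrite (_ : t - _ = (1 - ival s) * (t - t')) // /lin; ring.
have trans a a' a'' : good (g \o lin a a') -> good (g \o lin a' a'') ->
    good (g \o lin a a'').
  move=> g1 g2.
  apply: (@good_hom _ (pcat (g \o lin a a') (g \o lin a' a''))); last first.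
    by apply: good_cat => //; rewrite /= lin1 lin0.
  rewrite -(pcat_comp g (lin a a' : I -> R) (lin a' a'')).
  apply: homot_line => //; last 2 first.
  - by rewrite pcat0 !lin0.
  - by rewrite pcat1 !lin1.
  - by apply: pcat_cont => //; rewrite lin1 lin0.
pose P := [set t | good (g \o lin 0 t)].
suff PT : P = setT.
  have : P 1 by rewrite PT.
  rewrite /P /= (_ : g \o lin 0 1 = f) //; apply/funext => s.
  by rewrite /g /lin /= mulr0 add0r mulr1 ivalK.
have opP : open P.
  rewrite openE => t Pt; rewrite /interior.
  by apply: filterS (near_good t) => t' [gt _]; exact: trans gt.
have clP : closed P.
  rewrite -openC openE => t Pt; rewrite /interior.
  apply: filterS (near_good t) => t' [_ gt] Pt'; apply: Pt.
  exact: trans gt.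
have : connected [set: R] by apply/connected_intervalP => x y _ _ z _.
apply.
- exists 0; rewrite /P /= (_ : _ \o _ = fun=> g 0); last first.
    by apply/funext => s; rewrite /lin /= !mulr0 add0r.
  have [[y ->]|[j [d [_ ->]]]] := attach_case (g 0).
    by apply: (@good_base (fun=> y)); exact: cst_cont.
  by apply: (@good_cell j (fun=> d)); exact: cst_cont.
- by exists P; rewrite ?setTI.
- by exists P; rewrite ?setTI.
Qed.

(** The surjective half of van Kampen's theorem, in groupoid form.  The class [K]
stands for the paths of a known shape; leaving it abstract lets one statement
serve for edges glued to vertices and for disks glued to a graph. *)
Theorem attach_path (f : I -> X) (y y' : Y) : continuous f ->
  f zero = base y -> f one = base y' -> K f.
Proof.
move=> cf f0 f1; have := good_all cf; rewrite /good f0 f1 !acc_base pback_cst.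
have cf' : continuous (pcat f (fun=> base y')).
  by apply: pcat_cont => //; exact: cst_cont.
apply: K_hom; apply: homot_sym.
apply: (@homot_trans _ _ (pcat f (fun=> base y'))).
  by apply: homot_pcat1p; rewrite ?pcat0.
exact: homot_pcatp1.
Qed.

End attach_paths.

(** * Edge walks in a graph *)

Section retraced_walks.
Context {V : finType} {e : rel V} (e_sym : symmetric e).

Definition back (x : V) (p : seq V) := rev (belast x p).

Lemma last_back x p : last (last x p) (back x p) = x.
Proof. by rewrite /back; case: p => //= y p; rewrite rev_cons last_rcons. Qed.

Lemma path_back x p : path e x p -> path e (last x p) (back x p).
Proof. by rewrite rev_path; apply: sub_path => a b; rewrite e_sym. Qed.

Lemma backK x p : back (last x p) (back x p) = p.
Proof.
rewrite /back; case/lastP: p => [|p y] //=; rewrite last_rcons belast_rcons.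
by rewrite rev_cons belast_rcons rev_cons revK.
Qed.

End retraced_walks.

Section interval_as_cell.
Context {R : realType}.
Local Notation I := (I01 R).

Lemma ival_inj : injective (@ival R).
Proof. by move=> s t E; rewrite -[s]ivalK E ivalK. Qed.

Lemma closed_I01_set1 (t : I) : closed [set t].
Proof.
rewrite (_ : [set t] = @ival R @^-1` [set ival t]); last first.
  by apply/seteqP; split=> s /=; [move->|move/ival_inj].
apply: preimage_closed; first by move=> s _; exact: ival_continuous.
exact/accessible_closed_set1/hausdorff_accessible/Rhausdorff.
Qed.

Lemma closed_boundary1 : closed (@boundary1 R).
Proof.
rewrite (_ : (@boundary1 R) = [set zero] `|` [set one]) //.
by apply: closedU; exact: closed_I01_set1.
Qed.

Definition mid : I := clamp 2^-1.

Lemma ival_mid : ival mid = 2^-1.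
Proof. by rewrite clampK; lra. Qed.

Lemma mid_interior : ~ boundary1 mid.
Proof.
by case=> /(congr1 (@ival R)); rewrite ival_mid ?ival0 ?ival1; lra.
Qed.

Definition nearest_end (s : I) : R := if ival s < 2^-1 then 0 else 1.

Definition slide1 (z : I * I) : I :=
  clamp ((-1 * ival z.2 + 1) * ival z.1 + ival z.2 * nearest_end z.1).

Lemma nearest_end_locally_constant (s : I) : s <> mid ->
  \forall s' \near s, nearest_end s' = nearest_end s.
Proof.
move=> sm; have [lt_s|lt_s|eq_s] := ltgtP (ival s) 2^-1; last first.
- by case: sm; apply: ival_inj; rewrite ival_mid.
- have : \forall s' \near s, 2^-1 < ival s'.
    by have := cvgr_gt (ival s) (@ival_continuous R s); apply.
  apply: filterS => s' lt_s'.
  by rewrite /nearest_end !ifF //; apply/negbTE; rewrite -leNgt ltW.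
- have : \forall s' \near s, ival s' < 2^-1.
    by have := cvgr_lt (ival s) (@ival_continuous R s); apply.
  by apply: filterS => s' lt_s'; rewrite /nearest_end !ifT.
Qed.

Lemma slide1_continuous (s t : I) : s <> mid -> {for (s, t), continuous slide1}.
Proof.
move=> sm.
pose g (z : I * I) := clamp ((-1 * ival z.2 + 1) * ival z.1
                             + ival z.2 * nearest_end s) : I.
have cg : continuous g.
  apply: continuous_clamp; apply: continuous_interp.
  - by apply: continuous_ival => ?; exact: cvg_snd.
  - by apply: continuous_ival => ?; exact: cvg_fst.
  - exact: cst_continuous.
have gE : {near nbhs (s, t), g =1 slide1}.
  exists ([set s' | nearest_end s' = nearest_end s], setT) => /=.
    by split; [exact: nearest_end_locally_constant|exact: filterT].
  by move=> [s' t'] [/= ss' _]; rewrite /g /slide1 /= ss'.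
have C : g @ (s, t) --> slide1 (s, t) by exact: cg.
by apply: cvg_trans C; exact: near_eq_cvg.
Qed.

Lemma slide1_start (s : I) : slide1 (s, zero) = s.
Proof. by rewrite /slide1 /= ival0 mulr0 add0r mul1r mul0r addr0 ivalK. Qed.

Lemma slide1_endE (s : I) : slide1 (s, one) = clamp (nearest_end s).
Proof. by rewrite /slide1 /= ival1 mulr1 addNr mul0r add0r mul1r. Qed.

Lemma slide1_end (s : I) : boundary1 (slide1 (s, one)).
Proof. by rewrite slide1_endE /nearest_end; case: ifP; [left|right]. Qed.

Lemma slide1_fix (a t : I) : boundary1 a -> slide1 (a, t) = a.
Proof.
move=> [] ->; rewrite /slide1 /nearest_end /= ?ival0 ?ival1.
  by rewrite ifT ?mulr0 ?addr0 //; lra.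
rewrite ifF; last by apply/negbTE; lra.
by apply: clamp1; lra.
Qed.

End interval_as_cell.

Section edge_walks.
Context {R : realType} {V : finType} {e : rel V}.
Local Notation I := (I01 R).
Context (e_sym : symmetric e) (e_irr : irreflexive e).
Local Notation graph := (graph_space R e).
Local Notation vertex := (@graph_vertex R V e).
Local Notation attach1 := (@attach1 R V e).

Lemma vertex_inj : injective vertex.
Proof. by move=> x y E; exact: (base_pt_inj E). Qed.

Lemma edge_neq x y : e x y -> x != y.
Proof. by apply: contraTneq => ->; rewrite e_irr. Qed.

(** An edge is a single cell, oriented by the enumeration of V; the two cases are its
two possible orientations. *)
Lemma edge_cellP x y : e x y ->
  (exists p : cell1 e, [/\ val p = (x, y),
     forall t, graph_edge e x y t = cell_pt (@boundary1 R) attach1 p (clamp t) &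
     forall t, graph_edge e y x t = cell_pt (@boundary1 R) attach1 p (clamp (1 - t))]) \/
  (exists p : cell1 e, [/\ val p = (y, x),
     forall t, graph_edge e y x t = cell_pt (@boundary1 R) attach1 p (clamp t) &
     forall t, graph_edge e x y t = cell_pt (@boundary1 R) attach1 p (clamp (1 - t))]).
Proof.
move=> exy; have xy := edge_neq exy.
have C a b : e a b -> a != b -> (enum_rank a < enum_rank b)%N ->
    exists p : cell1 e, [/\ val p = (a, b),
     forall t, graph_edge e a b t = cell_pt (@boundary1 R) attach1 p (clamp t) &
     forall t, graph_edge e b a t = cell_pt (@boundary1 R) attach1 p (clamp (1 - t))].
  move=> eab ab lt_ab.
  have pab : is_cell1 e (a, b) by rewrite /is_cell1 /= eab.
  have pba : is_cell1 e (b, a) = false.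
    by rewrite /is_cell1 /= ltnNge (ltnW lt_ab) andbF.
  exists (Sub (a, b) pab); split=> // t; rewrite /graph_edge.
    by rewrite insubT.
  by rewrite insubF // insubT.
have [lt_xy|lt_yx|E] := ltngtP (enum_rank x) (enum_rank y).
- by left; exact: C.
- by right; apply: C => //; [rewrite e_sym|rewrite eq_sym].
- by move/val_inj/enum_rank_inj: E xy => ->; rewrite eqxx.
Qed.

Lemma graph_edge_continuous x y : continuous (graph_edge e x y : R -> graph).
Proof.
have ccell (p : cell1 e) (u : R -> R) : continuous u ->
    continuous (fun t => cell_pt (@boundary1 R) attach1 p (clamp (u t))).
  move=> cu; apply: (@continuous_comp_fun _ _ _ (cell_pt _ _ p)).
    exact: cell_pt_continuous.
  exact: continuous_clamp.
rewrite /graph_edge; case: insubP => [p _ _|_].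
  by apply: (ccell p id) => t; exact: cvg_id.
case: insubP => [p _ _|_]; last exact: cst_continuous.
apply: (ccell p (fun t => 1 - t)) => t.
by apply: cvgB; [exact: cvg_cst|exact: cvg_id].
Qed.

Lemma attach1_zero (p : cell1 e) :
  cell_pt (@boundary1 R) attach1 p zero = vertex (val p).1.
Proof.
rewrite cell_pt_boundary; last by left.
by rewrite /attach1 eqxx.
Qed.

Lemma attach1_one (p : cell1 e) :
  cell_pt (@boundary1 R) attach1 p one = vertex (val p).2.
Proof.
rewrite cell_pt_boundary; last by right.
by rewrite /attach1 eq_sym (negbTE I01_neq).
Qed.

Lemma graph_edge0 x y t : e x y -> t <= 0 -> graph_edge e x y t = vertex x :> graph.
Proof.
move=> exy t0; have [] := edge_cellP exy => -[p [pE E E']].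
  by rewrite E clamp0 // attach1_zero pE.
by rewrite E' clamp1 ?attach1_one ?pE //; lra.
Qed.

Lemma graph_edge1 x y t : e x y -> 1 <= t -> graph_edge e x y t = vertex y :> graph.
Proof.
move=> exy t0; have [] := edge_cellP exy => -[p [pE E E']].
  by rewrite E clamp1 // attach1_one pE.
by rewrite E' clamp0 ?attach1_zero ?pE //; lra.
Qed.

Lemma graph_edgeV x y t : e x y ->
  graph_edge e y x t = graph_edge e x y (1 - t) :> graph.
Proof.
move=> exy; have [] := edge_cellP exy => -[p [pE E E']].
  by rewrite E E'.
by rewrite E E'; congr cell_pt; congr clamp; lra.
Qed.

Definition edge_path x y (s : I) : graph := graph_edge e x y (ival s).

Lemma edge_path_cont x y : continuous (edge_path x y).
Proof.
apply: continuous_comp_fun; [exact: graph_edge_continuous|exact: ival_continuous].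
Qed.

Lemma edge_path0 x y : e x y -> edge_path x y zero = vertex x.
Proof. by move=> exy; rewrite /edge_path ival0 graph_edge0. Qed.

Lemma edge_path1 x y : e x y -> edge_path x y one = vertex y.
Proof. by move=> exy; rewrite /edge_path ival1 graph_edge1. Qed.

Lemma edge_path_back x y : e x y -> pback (edge_path x y) = edge_path y x.
Proof.
move=> exy; apply/funext => s; rewrite /pback /edge_path (graph_edgeV _ exy).
have := ival_ge0 s; have := ival_le1 s => s1 s0.
by rewrite clampK; [congr graph_edge; lra|lra].
Qed.

Fixpoint walk_path (x : V) (s : seq V) : I -> graph :=
  if s is y :: s' then pcat (edge_path x y) (walk_path y s')
  else fun=> vertex x.

Lemma walk_path0 x s : path e x s -> walk_path x s zero = vertex x.
Proof. by case: s => //= y s /andP[exy _]; rewrite pcat0 edge_path0. Qed.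

Lemma walk_path1 x s : walk_path x s one = vertex (last x s).
Proof. by elim: s x => //= y s IHs x; rewrite pcat1. Qed.

Lemma walk_path_cont x s : path e x s -> continuous (walk_path x s).
Proof.
elim: s x => [|y s IHs] x /=; first by move=> _; exact: cst_cont.
move=> /andP[exy pys]; apply: pcat_cont; [exact: edge_path_cont|exact: IHs|].
by rewrite edge_path1 // walk_path0.
Qed.

Lemma walk_path_cat x s t : path e x (s ++ t) ->
  homot (walk_path x (s ++ t)) (pcat (walk_path x s) (walk_path (last x s) t)).
Proof.
elim: s x => [|y s IHs] x /=.
  move=> pt; apply: homot_sym; apply: homot_pcat1p; first exact: walk_path_cont.
  exact: walk_path0.
move=> /andP[exy pst]; have := pst; rewrite cat_path => /andP[ps pt].
apply: (@homot_trans _ _ (pcat (edge_path x y)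
   (pcat (walk_path y s) (walk_path (last y s) t)))).
  apply: homot_pcat; [exact/homot_refl/edge_path_cont|exact: IHs|].
  by rewrite edge_path1 // walk_path0.
apply: homot_pcatA; [exact: edge_path_cont|exact: walk_path_cont..| |].
  by rewrite edge_path1 // walk_path0.
by rewrite walk_path1 walk_path0.
Qed.

Lemma walk_path_back x s : path e x s ->
  homot (walk_path (last x s) (back x s)) (pback (walk_path x s)).
Proof.
elim: s x => [|y s IHs] x /=; first by move=> _; exact/homot_refl/cst_cont.
move=> /andP[exy ps]; have eyx : e y x by rewrite e_sym.
rewrite pback_pcat; [|exact: edge_path_cont|exact: walk_path_cont|]; last first.
  by rewrite edge_path1 // walk_path0.
have pb : path e (last y s) (back y s ++ [:: x]).
  by rewrite cat_path path_back //= last_back eyx.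
rewrite /back /= rev_cons -cats1 -/(back y s).
apply: homot_trans (walk_path_cat pb) _.
rewrite last_back edge_path_back //.
apply: homot_pcat; [exact: IHs| |].
  apply: homot_pcatp1; [exact: edge_path_cont|exact: edge_path1].
by rewrite walk_path1 last_back walk_path0 /= ?eyx.
Qed.

Lemma walk_path1E x y : e x y -> homot (edge_path x y) (walk_path x [:: y]).
Proof.
move=> exy; apply/homot_sym/homot_pcatp1; [exact: edge_path_cont|].
exact: edge_path1.
Qed.

Lemma discrete_path_cst (u : I -> discrete_topology V) : continuous u ->
  forall s, u s = u zero.
Proof.
move=> cu s; pose P := [set t : R | u (clamp t) = u zero].
have cuc : continuous (fun t : R => u (clamp t)).
  by apply: continuous_comp_fun => //; exact: clamp_continuous.
have PE : P = (fun t : R => u (clamp t)) @^-1` [set u zero] by [].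
have PT : P = setT.
  have : connected [set: R] by apply/connected_intervalP => x y _ _ z _.
  apply.
  - by exists 0; rewrite /P /= clamp0.
  - exists P; rewrite ?setTI // PE; move/continuousP: cuc; apply.
    exact: discrete_open.
  - exists P; rewrite ?setTI // PE; move/continuous_closedP: cuc; apply.
    exact: discrete_closed.
have Ps : P (ival s) by rewrite PT.
by rewrite /P /= ivalK in Ps.
Qed.

Definition is_edge_walk (f : I -> graph) :=
  exists x s, path e x s /\ homot f (walk_path x s).

(** An interval being convex, such a path is determined by its ends: it is constant,
or runs along the edge in one of its two directions. *)
Lemma is_edge_walk_cell (p : cell1 e) (u : I -> I) : continuous u ->
  boundary1 (u zero) -> boundary1 (u one) ->
  is_edge_walk (cell_pt (@boundary1 R) attach1 p \o u).
Proof.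
move=> cu b0 b1.
have [exy xy] : e (val p).1 (val p).2 /\ (val p).1 != (val p).2.
  by have /andP[exy _] := valP p; split=> //; exact: edge_neq.
pose c (t : R) := cell_pt (@boundary1 R) attach1 p (clamp t).
have cc : continuous c.
  apply: continuous_comp_fun; last exact: clamp_continuous.
  exact: cell_pt_continuous.
have line (v : I -> R) : continuous v -> v zero = ival (u zero) ->
    v one = ival (u one) -> homot (cell_pt (@boundary1 R) attach1 p \o u) (c \o v).
  move=> cv v0 v1.
  rewrite (_ : _ \o u = fun s => c (ival (u s))); last first.
    by apply/funext => s; rewrite /c ivalK.
  by apply: homot_line => //; exact: continuous_ival.
have cE : edge_path (val p).1 (val p).2 = c \o @ival R.
  apply/funext => s; rewrite /edge_path /graph_edge -surjective_pairing.
  by rewrite valK.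
case: b0 => u0; case: b1 => u1.
- exists (val p).1, [::]; split=> //=; rewrite -attach1_zero.
  rewrite (_ : (fun=> _) = c \o fun=> 0); last first.
    by apply/funext => s; rewrite /c /= clamp0.
  by apply: line; rewrite ?u0 ?u1 ?ival0 //; exact: cst_continuous.
- exists (val p).1, [:: (val p).2]; split=> /=; first by rewrite exy.
  apply: homot_trans (walk_path1E exy); rewrite cE.
  by apply: line; rewrite ?u0 ?u1 //; exact: ival_continuous.
- exists (val p).2, [:: (val p).1]; rewrite /= e_sym exy; split=> //.
  have eyx : e (val p).2 (val p).1 by rewrite e_sym.
  apply: homot_trans (walk_path1E eyx); rewrite -edge_path_back // cE.
  apply: line.
  + apply: continuous_ival; apply: continuous_clamp.
    exact/continuous_affine/ival_continuous.
  + by rewrite ival0 u0 ival1 clamp1 ?ival1 //; lra.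
  + by rewrite ival1 u1 ival0 clamp0 ?ival0 //; lra.
- exists (val p).2, [::]; split=> //=; rewrite -attach1_one.
  rewrite (_ : (fun=> _) = c \o fun=> 1); last first.
    by apply/funext => s; rewrite /c /= clamp1.
  by apply: line; rewrite ?u0 ?u1 ?ival1 //; exact: cst_continuous.
Qed.

(** Paths among the vertices are constant, so by [attach_path] only the paths inside a
single edge remain. *)
Theorem graph_path_walk (f : I -> graph) x y : continuous f ->
  f zero = vertex x -> f one = vertex y ->
  exists s, [/\ path e x s, last x s = y & homot f (walk_path x s)].
Proof.
move=> cf f0 f1.
suff [x' [s [ps fs]]] : is_edge_walk f.
  have [] := homot_ends fs; rewrite walk_path0 // walk_path1 f0 f1.
  move=> /vertex_inj xx' /vertex_inj ys.
  by exists s; rewrite xx' -ys.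
apply: (@attach_path R (discrete_topology V) I (cell1 e) (@boundary1 R) attach1
  mid slide1 closed_boundary1 mid_interior (@closed_I01_set1 R mid)
  slide1_continuous slide1_start (fun d _ => slide1_end d) slide1_fix _
  zero (or_introl erefl) _ is_edge_walk _ _ _ is_edge_walk_cell f x y
  cf f0 f1).
- move=> p d dm U nU.
  have Ud : U (attach1 p (slide1 (d, one))) by exact: (nbhs_singleton nU).
  have : nbhs d [set d' | U (attach1 p (slide1 (d', one)))].
    apply: filterS (nearest_end_locally_constant dm) => d' E /=.
    by rewrite slide1_endE E -slide1_endE.
  by [].
- move=> d; exists (fun s => clamp (ival d * ival s + 0)); split.
  + by apply: continuous_clamp; apply: continuous_affine; exact: ival_continuous.
  + by rewrite ival0 clamp0 //; lra.
  + by rewrite ival1 mulr1 addr0 ivalK.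
- move=> g h gh [x' [s [ps hs]]]; exists x', s; split=> //.
  exact: homot_trans hs.
- move=> g h [x' [s [ps gs]]] [y' [t [pt ht]]] gh.
  have E : last x' s = y'.
    apply: vertex_inj; rewrite -walk_path1 -(walk_path0 pt).
    by rewrite -(homot_ends gs).2 -(homot_ends ht).1.
  exists x', (s ++ t); rewrite cat_path ps E pt; split=> //.
  apply: homot_trans (homot_pcat gs ht gh) _; rewrite -E.
  by apply/homot_sym/walk_path_cat; rewrite cat_path ps E.
- move=> u /discrete_path_cst uE; exists (u zero), [::]; split=> //=.
  rewrite (_ : _ \o u = fun=> vertex (u zero)); first exact/homot_refl/cst_cont.
  by apply/funext => s; rewrite /= uE.
Qed.

End edge_walks.

(** * The disk as a cell *)

Section disk_as_cell.
Context {R : realType}.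
Local Notation I := (I01 R).
Local Notation disk := (disk R).

Lemma cont_at_mul (Y : topologicalType) (u v : Y -> R) (y : Y) :
  {for y, continuous u} -> {for y, continuous v} ->
  {for y, continuous (fun y => u y * v y)}.
Proof. by move=> cu cv; apply: cvgM. Qed.

Lemma cont_at_add (Y : topologicalType) (u v : Y -> R) (y : Y) :
  {for y, continuous u} -> {for y, continuous v} ->
  {for y, continuous (fun y => u y + v y)}.
Proof. by move=> cu cv; apply: cvgD. Qed.

Lemma cont_at_pair (Y A B : topologicalType) (u : Y -> A) (v : Y -> B) (y : Y) :
  {for y, continuous u} -> {for y, continuous v} ->
  {for y, continuous (fun y => (u y, v y))}.
Proof. by move=> cu cv; apply: cvg_pair; [exact: cu|exact: cv]. Qed.

Definition norm2 (z : R * R) : R := Num.sqrt (z.1 ^+ 2 + z.2 ^+ 2).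

Lemma sqr_norm2 z : norm2 z ^+ 2 = z.1 ^+ 2 + z.2 ^+ 2.
Proof. by rewrite sqr_sqrtr // addr_ge0 ?sqr_ge0. Qed.

Lemma norm2_ge0 z : 0 <= norm2 z. Proof. exact: sqrtr_ge0. Qed.

Lemma norm2_eq1 z : norm2 z = 1 <-> z.1 ^+ 2 + z.2 ^+ 2 = 1.
Proof. by rewrite /norm2; split=> [E|->]; [rewrite -sqr_norm2 /norm2 E expr1n|rewrite sqrtr1]. Qed.

Lemma norm2_continuous : continuous norm2.
Proof.
move=> z; apply: (@continuous_comp _ _ _ (fun z : R * R => z.1 ^+ 2 + z.2 ^+ 2) Num.sqrt); last first.
  exact: sqrt_continuous.
have c1 : {for z, continuous (fun z : R * R => z.1 : R)} by exact: cvg_fst.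
have c2 : {for z, continuous (fun z : R * R => z.2 : R)} by exact: cvg_snd.
by apply: cvgD; rewrite ?expr2; apply: cvgM.
Qed.

Lemma to_disk_subproof (z : R * R) :
  (z.1 / Num.max 1 (norm2 z), z.2 / Num.max 1 (norm2 z)) \in
  [set z : R * R | z.1 ^+ 2 + z.2 ^+ 2 <= 1].
Proof.
rewrite inE /= !exprMn -mulrDl -sqr_norm2 exprVn.
set m := Num.max _ _; have m1 : 1 <= m by rewrite le_max lexx.
have mn : norm2 z <= m by rewrite le_max lexx orbT.
rewrite ler_pdivrMr ?mul1r; last by rewrite exprn_gt0 //; lra.
by rewrite ler_sqr ?nnegrE ?norm2_ge0 //; lra.
Qed.

(** The retraction of the plane onto the disk, through which the convexity of the
plane is used inside a cell. *)
Definition to_disk (z : R * R) : disk := SigSub (to_disk_subproof z).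

Definition disk_coord (d : disk) : R * R := \val d.

Lemma disk_coord_inj : injective disk_coord. Proof. exact: val_inj. Qed.

Lemma disk_coord_le1 d : norm2 (disk_coord d) <= 1.
Proof.
case: d => z dz; have := dz; rewrite inE /= => h; rewrite /disk_coord /=.
by rewrite -(@ler_sqr _ _ 1) ?nnegrE ?norm2_ge0 // sqr_norm2 expr1n.
Qed.

Lemma to_diskK z : norm2 z <= 1 -> disk_coord (to_disk z) = z.
Proof.
by move=> z1; rewrite /disk_coord /= max_l // !divr1 -surjective_pairing.
Qed.

Lemma disk_coordK d : to_disk (disk_coord d) = d.
Proof. by apply: disk_coord_inj; rewrite to_diskK // disk_coord_le1. Qed.

Lemma disk_coord_continuous : continuous disk_coord.
Proof. exact: initial_continuous. Qed.

Lemma to_disk_continuous : continuous to_disk.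
Proof.
apply: continuous_comp_initial => z.
have cm : {for z, continuous (fun z => (Num.max 1 (norm2 z))^-1)}.
  apply: (@cvgV R); first by rewrite gt_eqF // lt_max ltr01.
  apply: (@continuous_max R (R * R)%type (fun=> 1) norm2); first exact: cvg_cst.
  exact: norm2_continuous.
have c1 : {for z, continuous (fun z : R * R => z.1 : R)} by exact: cvg_fst.
have c2 : {for z, continuous (fun z : R * R => z.2 : R)} by exact: cvg_snd.
exact: (cont_at_pair (cont_at_mul c1 cm) (cont_at_mul c2 cm)).
Qed.

Lemma closed_level (X : topologicalType) (g : X -> R) (a : R) :
  continuous g -> closed [set x | g x = a].
Proof.
move=> cg; rewrite (_ : [set _ | _] = g @^-1` [set a]) //.
apply: preimage_closed; first by move=> s _; exact: cg.
exact/accessible_closed_set1/hausdorff_accessible/Rhausdorff.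
Qed.

Definition radius (d : disk) : R := norm2 (disk_coord d).

Lemma radius_continuous : continuous radius.
Proof.
apply: continuous_comp_fun; [exact: norm2_continuous|exact: disk_coord_continuous].
Qed.

Lemma boundary2E : @boundary2 R = [set d | radius d = 1].
Proof.
by apply/seteqP; split=> d; rewrite /boundary2 /radius /=; move/norm2_eq1.
Qed.

Lemma closed_boundary2 : closed (@boundary2 R).
Proof. by rewrite boundary2E; apply: closed_level; exact: radius_continuous. Qed.

Definition disk_center : disk := to_disk (0, 0).

Lemma norm2_00 : norm2 (0, 0) = 0.
Proof. by rewrite /norm2 /= !expr0n addr0 sqrtr0. Qed.

Lemma radius_center d : radius d = 0 <-> d = disk_center.
Proof.
split=> [|->]; last by rewrite /radius to_diskK norm2_00.
move=> r0; apply: disk_coord_inj; rewrite to_diskK ?norm2_00 //.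
have := sqr_norm2 (disk_coord d); rewrite -/(radius d) r0 expr0n /=.
move: (disk_coord d) => [a b] /= /esym/eqP.
by rewrite paddr_eq0 ?sqr_ge0 // !sqrf_eq0 => /andP[/eqP-> /eqP->].
Qed.

Lemma closed_center : closed [set disk_center].
Proof.
rewrite (_ : [set disk_center] = [set d | radius d = 0]).
  by apply: closed_level; exact: radius_continuous.
by apply/seteqP; split=> d; move/radius_center.
Qed.

Lemma disk_center_interior : ~ boundary2 disk_center.
Proof.
by rewrite boundary2E /= (proj2 (radius_center _)) // => /eqP; rewrite eq_sym oner_eq0.
Qed.

(** The factor (1 - t) + t / |z|, which moves z linearly to z / |z|. *)
Definition stretch (z : disk * I) : R :=
  (-1 * ival z.2 + 1) * 1 + ival z.2 * (radius z.1)^-1.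

Definition slide2 (z : disk * I) : disk :=
  to_disk (stretch z * (disk_coord z.1).1, stretch z * (disk_coord z.1).2).

Lemma slide2_continuous (d : disk) (t : I) : d <> disk_center ->
  {for (d, t), continuous slide2}.
Proof.
move=> dc.
have cz1 : continuous (fun z : disk * I => z.1) by move=> ?; exact: cvg_fst.
have cz2 : continuous (fun z : disk * I => ival z.2).
  by apply: continuous_ival => ?; exact: cvg_snd.
have cr : continuous (fun z : disk * I => radius z.1).
  by apply: continuous_comp_fun => //; exact: radius_continuous.
have cs : {for (d, t), continuous stretch}.
  apply: (@cont_at_add _ (fun z => (-1 * ival z.2 + 1) * 1)
            (fun z => ival z.2 * (radius z.1)^-1)); apply: cont_at_mul.
  - exact: (@continuous_affine R _ (-1) 1 _ cz2 (d, t)).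
  - exact: cvg_cst.
  - exact: cz2.
  - apply: cvgV; last exact: cr.
    by apply/eqP => /radius_center.
have cc : continuous (fun z : disk * I => disk_coord z.1).
  by apply: continuous_comp_fun => //; exact: disk_coord_continuous.
have cc1 : continuous (fun z : disk * I => (disk_coord z.1).1).
  by apply: (@continuous_comp_fun _ _ _ (@fst R R)) => // ?; exact: cvg_fst.
have cc2 : continuous (fun z : disk * I => (disk_coord z.1).2).
  by apply: (@continuous_comp_fun _ _ _ (@snd R R)) => // ?; exact: cvg_snd.
apply: (@continuous_comp _ _ _ (fun z : disk * I =>
  (stretch z * (disk_coord z.1).1, stretch z * (disk_coord z.1).2)) to_disk).
  apply: cont_at_pair; apply: cont_at_mul => //; [exact: cc1|exact: cc2].
exact: to_disk_continuous.
Qed.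

Lemma slide2_start (d : disk) : slide2 (d, zero) = d.
Proof.
rewrite /slide2 /stretch /= ival0 mulr0 add0r mul0r mulr1 addr0 !mul1r.
by rewrite -surjective_pairing disk_coordK.
Qed.

Lemma slide2_fix (a : disk) (t : I) : boundary2 a -> slide2 (a, t) = a.
Proof.
rewrite boundary2E /= => a1.
rewrite /slide2 /stretch /= a1 invr1.
rewrite (_ : (-1 * _ + 1) * 1 + _ = 1); last by ring.
by rewrite !mul1r -surjective_pairing disk_coordK.
Qed.

Lemma norm2_scale k z : norm2 (k * z.1, k * z.2) = `|k| * norm2 z.
Proof.
by rewrite /norm2 /= !exprMn -mulrDr sqrtrM ?sqr_ge0 // sqrtr_sqr.
Qed.

Lemma slide2_end (d : disk) : d <> disk_center -> boundary2 (slide2 (d, one)).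
Proof.
move=> dc; rewrite boundary2E /= /slide2.
have rd : radius d != 0 by apply/eqP => /radius_center.
have sE : stretch (d, one) = (radius d)^-1.
  by rewrite /stretch /= ival1; ring.
have n1 : norm2 (stretch (d, one) * (disk_coord d).1,
                 stretch (d, one) * (disk_coord d).2) = 1.
  by rewrite norm2_scale sE -/(radius d) ger0_norm ?invr_ge0 ?norm2_ge0 // mulVf.
by rewrite /radius to_diskK n1.
Qed.

Definition circle (t : R) : disk := to_disk (cos (2 * pi * t), sin (2 * pi * t)).

Lemma norm2_circle t : norm2 (cos t, sin t) = 1.
Proof. by apply/norm2_eq1; rewrite /= cos2Dsin2. Qed.

Lemma circleE t : disk_coord (circle t) = (cos (2 * pi * t), sin (2 * pi * t)).
Proof. by rewrite to_diskK // norm2_circle. Qed.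

Lemma circle_boundary t : boundary2 (circle t).
Proof. by rewrite boundary2E /= /radius circleE norm2_circle. Qed.

Lemma circle1 : circle 1 = circle 0.
Proof.
apply: disk_coord_inj; rewrite !circleE mulr1 mulr0 cos0 sin0.
by rewrite mulr_natl cos2pi sin2pi.
Qed.

Lemma continuous_scale (f : R -> R) (k : R) :
  continuous f -> continuous (fun t => f (k * t)).
Proof.
move=> cf; apply: (@continuous_comp_fun _ _ _ f (fun t => k * t)) => // t.
by apply: cvgM; [exact: cvg_cst|exact: cvg_id].
Qed.

Lemma circle_continuous : continuous circle.
Proof.
apply: (@continuous_comp_fun _ _ _ to_disk); first exact: to_disk_continuous.
apply: continuous_pair_map; apply: continuous_scale.
  exact: continuous_cos.
exact: continuous_sin.
Qed.

Lemma cos_eq1 (x : R) : 0 <= x < 2 * pi -> cos x = 1 -> x = 0.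
Proof.
move=> /andP[x0 x2]; have -> : x = (x / 2) *+ 2 by rewrite -mulr_natr; field.
rewrite cos_mulr2n; set y := x / 2 => E.
have y0 : 0 <= y by rewrite /y; lra.
have ypi : y < pi by rewrite /y; lra.
have [->|ygt] := eqVneq y 0; first by rewrite mul0rn.
have : 0 < sin y by apply: sin_gt0_pi; rewrite ypi andbT lt_neqAle eq_sym ygt.
have := cos2Dsin2 y; rewrite -mulr_natr in E => sE sy.
have : sin y ^+ 2 = 0 by lra.
by move/eqP; rewrite sqrf_eq0 gt_eqF.
Qed.

Lemma circle_inj (s t : R) : 0 <= s < 1 -> 0 <= t < 1 ->
  circle s = circle t -> s = t.
Proof.
have pi0 := pi_gt0 R.
wlog st : s t / s <= t.
  move=> wl s1 t1 E; have [st|/ltW ts] := leP s t; first exact: wl.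
  exact/esym/wl.
move=> /andP[s0 s1] /andP[t0 t1] /(congr1 disk_coord); rewrite !circleE => -[Ec Es].
suff : 2 * pi * (t - s) = 0.
  move/eqP; rewrite mulf_eq0 [_ == 0]gt_eqF /=; last by rewrite mulr_gt0.
  by rewrite subr_eq0 => /eqP.
apply: cos_eq1.
  by rewrite mulr_ge0 /= ?subr_ge0 //; [rewrite gtr_pMr ?mulr_gt0 //; lra|rewrite mulr_ge0 // ltW].
by rewrite mulrBr cosB Ec Es -!expr2 cos2Dsin2.
Qed.

Lemma circle_surj (d : disk) : boundary2 d -> exists2 t, 0 <= t < 1 & d = circle t.
Proof.
have pi0 := pi_gt0 R; have pi2 : 0 < 2 * pi :> R by rewrite mulr_gt0.
rewrite /boundary2 /=; case E : (\val d) => [a b] /= ab.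
have a1 : -1 <= a <= 1.
  have : a ^+ 2 <= 1 by have := sqr_ge0 b; lra.
  by move=> a2; rewrite -ler_norml -(@expr_le1 _ 2) // real_normK ?num_real.
have bE : Num.sqrt (1 - a ^+ 2) = `|b|.
  by rewrite (_ : 1 - _ = b ^+ 2) ?sqrtr_sqr //; lra.
have ac0 := acos_ge0 a1; have acpi := acos_lepi a1.
have C0 (t : R) : a = cos (2 * pi * t) -> b = sin (2 * pi * t) -> d = circle t.
  by move=> aE bE'; apply: disk_coord_inj; rewrite circleE /disk_coord E aE bE'.
have [b0|b0] := leP 0 b.
  exists (acos a / (2 * pi)).
    by rewrite divr_ge0 ?(ltW pi2) //= ltr_pdivrMr // mul1r; lra.
  have tE : 2 * pi * (acos a / (2 * pi)) = acos a.
    by rewrite mulrC divfK // gt_eqF.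
  by apply: C0; rewrite tE ?acosK ?in_itv //= sin_acos // bE ger0_norm.
have ac_gt0 : acos a != 0.
  apply/eqP => ac; move: b0; have := acosK (_ : a \in `[-1, 1]%R).
  rewrite in_itv /= a1 ac cos0 => /(_ isT) aE.
  have : b ^+ 2 = 0 by move: ab; rewrite -aE expr1n; lra.
  by move/eqP; rewrite sqrf_eq0 => /eqP ->; rewrite ltxx.
exists (1 - acos a / (2 * pi)).
  have q0 : 0 < acos a / (2 * pi).
    by apply: divr_gt0 => //; rewrite lt_neqAle eq_sym ac_gt0.
  have q1 : acos a / (2 * pi) <= 1 by rewrite ler_pdivrMr // mul1r; lra.
  by lra.
have tE : 2 * pi * (1 - acos a / (2 * pi)) = - acos a + pi *+ 2.
  have G (p : R) : 0 < p -> 2 * p * (1 - acos a / (2 * p)) = - acos a + 2 * p.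
    by move=> p0; field; rewrite gt_eqF.
  by rewrite G // mulr_natl.
apply: C0; rewrite tE ?cosD2pi ?sinD2pi.
  by rewrite cosN acosK // in_itv.
by rewrite sinN sin_acos // bE ltr0_norm // opprK.
Qed.

End disk_as_cell.

(** * Edge walks in the short-cycle complex *)

Section two_cells.
Context {R : realType} {V : finType} {e : rel V}.
Local Notation I := (I01 R).
Context (e_sym : symmetric e) (e_irr : irreflexive e).
Local Notation graph := (graph_space R e).
Local Notation vertex := (@graph_vertex R V e).

(** The walk run at unit speed, the form in which it can be compared with the
constant-speed boundary walk of a 2-cell. *)
Fixpoint walk_line (x : V) (s : seq V) (u : R) : graph :=
  if s is y :: s' then
    if u <= 1 then graph_edge e x y u else walk_line y s' (u - 1)
  else vertex x.

Lemma walk_line0 x s u : path e x s -> u <= 0 -> walk_line x s u = vertex x.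
Proof.
case: s => //= y s /andP[exy _] u0.
by rewrite ifT ?(graph_edge0 e_sym e_irr exy) //; lra.
Qed.

Lemma walk_line1 x s u : path e x s -> (size s)%:R <= u ->
  walk_line x s u = vertex (last x s).
Proof.
elim: s x u => //= y s IHs x u /andP[exy ps] su.
have su' : (size s)%:R <= u - 1 by rewrite -natr1 in su; lra.
case: ifP => [u1|_]; last exact: IHs.
have u_eq : u = 1 by have := ler0n R (size s); lra.
rewrite (graph_edge1 e_sym e_irr exy) ?u_eq //; move: su'; rewrite u_eq subrr.
by rewrite lern0 size_eq0 => /eqP ->.
Qed.

Lemma walk_line_continuous x s : path e x s -> continuous (walk_line x s).
Proof.
elim: s x => [|y s IHs] x /=; first by move=> _; exact: cst_continuous.
move=> /andP[exy ps].
have E : walk_line x (y :: s) = fun u : R => if 2^-1 * u + 0 <= 2^-1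
    then graph_edge e x y u else walk_line y s (u - 1).
  apply/funext => u /=; congr (if _ then _ else _).
  by apply/idP/idP; lra.
rewrite [X in continuous X](_ : _ = walk_line x (y :: s)) // E.
apply: paste_continuous.
- by apply: continuous_affine => u; exact: cvg_id.
- exact: graph_edge_continuous.
- apply: continuous_comp_fun; first exact: IHs.
  by move=> u; apply: cvgB; [exact: cvg_id|exact: cvg_cst].
- move=> u u1; have -> : u = 1 by lra.
  by rewrite (graph_edge1 e_sym e_irr exy) // walk_line0 // subrr.
Qed.

Lemma walk_line_step x y s u : path e x (y :: s) -> 0 <= u ->
  walk_line x (y :: s) (u + 1) = walk_line y s u.
Proof.
move=> /= /andP[exy ps] u0; case: ifP => [u1|_]; last by rewrite addrK.
have -> : u = 0 by lra.
by rewrite (graph_edge1 e_sym e_irr exy) ?walk_line0 // add0r.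
Qed.

Lemma walk_line_homot x s (v : I -> R) : path e x s -> continuous v ->
  v zero = 0 -> v one = (size s)%:R ->
  homot (walk_line x s \o v) (walk_path x s).
Proof.
elim: s x v => [|y s IHs] x v ps cv v0 v1 /=.
  exact/homot_refl/cst_cont.
have /andP[exy pys] : path e x (y :: s) by [].
pose w (t : I) : R := (size s)%:R * ival t + 0.
have cw : continuous w by apply: continuous_affine; exact: ival_continuous.
have w0 : w zero = 0 by rewrite /w ival0; lra.
have w1 : w one = (size s)%:R by rewrite /w ival1; lra.
have w_ge0 t : 0 <= w t by rewrite /w addr0 mulr_ge0 ?ival_ge0.
have cw1 : continuous (fun t => w t + 1).
  rewrite (_ : (fun t => _) = fun t => 1 * w t + 1); first exact: continuous_affine.
  by apply/funext => t; rewrite mul1r.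
have cl := walk_line_continuous ps.
apply: (@homot_trans _ _ (pcat (edge_path x y) (walk_line y s \o w))); last first.
  apply: homot_pcat; [exact/homot_refl/edge_path_cont|exact: IHs|].
  by rewrite (edge_path1 e_sym e_irr exy) /= w0 walk_line0.
rewrite (_ : edge_path x y = walk_line x (y :: s) \o @ival R); last first.
  by apply/funext => t; rewrite /edge_path /= ival_le1.
rewrite (_ : walk_line y s \o w = walk_line x (y :: s) \o (fun t => w t + 1)); last first.
  by apply/funext => t; rewrite [RHS]walk_line_step.
rewrite -pcat_comp; apply: homot_line => //.
- apply: pcat_cont => //; first exact: ival_continuous.
  by rewrite ival1 w0 add0r.
- by rewrite pcat0 ival0.
- by rewrite pcat1 w1 v1 /= natr1.
Qed.

(** The bridge to the explicit formula by which 2-cells are attached. *)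
Lemma walk_lineE x s (u : R) x0 : path e x s -> 0 <= u < (size s)%:R ->
  walk_line x s u = graph_edge e (nth x0 (x :: s) (Num.truncn u))
    (nth x0 (x :: s) (Num.truncn u).+1) (u - (Num.truncn u)%:R).
Proof.
elim: s x u => [|y s IHs] x u; first by move=> _ /= H; exfalso; lra.
move=> ps /andP[u0 us]; have /andP[exy pys] : path e x (y :: s) by [].
have [u1|u1] := ltP u 1.
  have -> : Num.truncn u = 0%N by apply: truncn_def; rewrite u0.
  by rewrite /= subr0 ifT // ltW.
have uE : u = (u - 1) + 1 by lra.
have tE : Num.truncn u = (Num.truncn (u - 1)).+1.
  have u10 : 0 <= u - 1 by lra.
  have /andP[t1 t2] := truncn_itv u10.
  by apply: truncn_def; rewrite -!natr1 in t2 *; lra.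
have us' : u - 1 < (size s)%:R by rewrite /= -natr1 in us; lra.
rewrite {1}uE walk_line_step //; last by lra.
rewrite IHs //; last by rewrite us' andbT; lra.
by rewrite tE /=; congr graph_edge; rewrite -natr1; lra.
Qed.

Context (k : nat).
Local Notation X := (short_cycle_complex R e k).
Local Notation attach2 := (@attach2 R V e k).
Local Notation base := (@base_pt graph (disk R) (cell2 e k) (@boundary2 R) attach2).
Local Notation cell := (@cell_pt graph (disk R) (cell2 e k) (@boundary2 R) attach2).

Definition boundary_walk (c : V * seq V) := rcons c.2 c.1.

Lemma boundary_walk_path (c : cell2 e k) :
  path e (val c).1 (boundary_walk (val c)).
Proof. by case: c => -[x s] /= /and5P[]. Qed.

(** The formula extends to t = 1, where the circle closes up, because the boundary
walk is then back at its first vertex. *)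
Lemma attach2_circle (c : cell2 e k) (t : R) : 0 <= t <= 1 ->
  attach2 c (circle t) = walk_line (val c).1 (boundary_walk (val c))
    ((size (boundary_walk (val c)))%:R * t).
Proof.
move=> /andP[t0 t1]; have pw := boundary_walk_path c.
wlog {t1} t1 : t t0 / t < 1.
  move=> wl; move: t1; rewrite le_eqVlt => /predU1P[->|]; last exact: wl.
  rewrite circle1 wl // mulr1 mulr0 walk_line0 // walk_line1 //.
  by rewrite /boundary_walk last_rcons.
have turnE : turn (\val (circle t)) = t.
  rewrite /turn; case: xgetP => [s _ [s01 sE]|/(_ t)]; last first.
    by case; split; [rewrite t0|rewrite -[LHS]/(disk_coord _) circleE].
  apply: circle_inj => //; first by rewrite t0.
  by apply: disk_coord_inj; rewrite circleE -sE.
rewrite /attach2 turnE /cycle_walk /=.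
have sE : size (boundary_walk (val c)) = (size (val c).2).+1.
  by rewrite /boundary_walk size_rcons.
rewrite (@walk_lineE _ _ _ (val c).1 pw) sE; last first.
  by rewrite mulr_ge0 //= gtr_pMr.
set u := _ * t; have u0 : 0 <= u by rewrite mulr_ge0.
have lt_u : (Num.truncn u < (size (val c).2).+1)%N.
  by rewrite truncn_lt_nat // gtr_pMr.
congr graph_edge; rewrite /boundary_walk -rcons_cons nth_rcons /=.
  by rewrite lt_u.
case: ltnP => // le_u; rewrite [LHS]nth_default //.
by case: ifP.
Qed.

Lemma boundary_cont (c : cell2 e k) :
  continuous (fun t : I => attach2 c (circle (ival t))).
Proof.
rewrite (_ : (fun _ => _) = fun t => walk_line (val c).1
    (boundary_walk (val c)) ((size (boundary_walk (val c)))%:R * ival t + 0)).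
  apply: continuous_comp_fun; first exact/walk_line_continuous/boundary_walk_path.
  exact/continuous_affine/ival_continuous.
by apply/funext => t; rewrite attach2_circle ?ival_ge0 ?ival_le1 // addr0.
Qed.

Lemma boundary_homot (c : cell2 e k) :
  homot (fun t : I => attach2 c (circle (ival t)))
        (walk_path (val c).1 (boundary_walk (val c))).
Proof.
pose v (t : I) : R := (size (boundary_walk (val c)))%:R * ival t + 0.
rewrite (_ : (fun _ => _) = walk_line (val c).1 (boundary_walk (val c)) \o v).
  apply: walk_line_homot; first exact: boundary_walk_path.
  - exact/continuous_affine/ival_continuous.
  - by rewrite /v ival0; lra.
  - by rewrite /v ival1; lra.
by apply/funext => t; rewrite attach2_circle ?ival_ge0 ?ival_le1 // /v /= addr0.
Qed.

Lemma cell_circle_base (c : cell2 e k) t :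
  cell c (circle t) = base (attach2 c (circle t)).
Proof. by apply: cell_pt_boundary; exact: circle_boundary. Qed.

Lemma to_disk_cell_cont (c : cell2 e k) : continuous (cell c \o @to_disk R).
Proof. by apply: comp_cont; [exact: cell_pt_continuous|exact: to_disk_continuous]. Qed.

Lemma cell_homot (c : cell2 e k) (u v : I -> disk R) :
  continuous u -> continuous v -> u zero = v zero -> u one = v one ->
  homot (cell c \o u) (cell c \o v).
Proof.
move=> cu cv E0 E1.
have cc (w : I -> disk R) : continuous w ->
    continuous (fun s => (disk_coord (w s)).1) /\
    continuous (fun s => (disk_coord (w s)).2).
  move=> cw; have cdw : continuous (disk_coord \o w).
    by apply: comp_cont => //; exact: disk_coord_continuous.
  split.
    by apply: (@continuous_comp_fun _ _ _ (@fst R R)) => // ?; exact: cvg_fst.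
  by apply: (@continuous_comp_fun _ _ _ (@snd R R)) => // ?; exact: cvg_snd.
have [cu1 cu2] := cc u cu; have [cv1 cv2] := cc v cv.
have E (w : I -> disk R) : cell c \o w = fun s => (cell c \o @to_disk R)
    ((disk_coord (w s)).1, (disk_coord (w s)).2).
  by apply/funext => s; rewrite /= -surjective_pairing disk_coordK.
rewrite !E; apply: homot_plane => //; rewrite ?E0 ?E1 //.
exact: to_disk_cell_cont.
Qed.

Lemma circle_ival_cont : continuous (fun t : I => circle (ival t)).
Proof.
apply: continuous_comp_fun; [exact: circle_continuous|exact: ival_continuous].
Qed.

(** The boundary walk of a 2-cell contracts inside the cell. *)
Lemma short_cycle_null (c : cell2 e k) :
  homot (base \o walk_path (val c).1 (boundary_walk (val c)))
        (fun=> base (vertex (val c).1)).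
Proof.
apply: homot_trans (homot_comp (@base_pt_continuous _ _ _ _ _)
  (homot_sym (boundary_homot c))) _.
rewrite (_ : base \o _ = cell c \o fun t : I => circle (ival t)); last first.
  by apply/funext => t; rewrite /= cell_circle_base.
rewrite (_ : (fun=> _) = cell c \o fun=> circle 0); last first.
  apply/funext => t; rewrite /= cell_circle_base attach2_circle ?lexx ?ler01 //.
  by rewrite mulr0 walk_line0 //; exact: boundary_walk_path.
apply: cell_homot; first exact: circle_ival_cont.
- exact: cst_continuous.
- by rewrite ival0.
- by rewrite ival1 circle1.
Qed.

(** The angle jumps at the point (1, 0), but the interval covers the circle by a
closed map, and composed with that map the attaching map is the continuous
boundary walk. *)
Lemma attach2_slide2_cont (c : cell2 e k) (d : disk R) : d <> disk_center ->
  {for d, continuous (fun d => attach2 c (slide2 (d, one)))}.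
Proof.
move=> dc U nU.
have [W [oW Wd] WU] : exists2 W, open_nbhs (attach2 c (slide2 (d, one))) W & W `<=` U.
  by have : nbhs (attach2 c (slide2 (d, one))) U by []; rewrite nbhsE.
pose C : set I := (fun t : I => attach2 c (circle (ival t))) @^-1` (~` W).
have clC : closed C.
  have /continuous_closedP := @boundary_cont c; apply.
  exact: open_closedC.
have cC : compact C by apply: subclosed_compact clC (@compact_I01 R) _.
pose Z : set (R * R) := (disk_coord \o (fun t : I => circle (ival t))) @` C.
have clZ : closed Z.
  apply: compact_closed; first exact: norm_hausdorff.
  apply: continuous_compact => //; apply: continuous_subspaceT.
  by apply: comp_cont; [exact: disk_coord_continuous|exact: circle_ival_cont].
have /circle_surj[t0 /andP[t00 t01] t0E] := slide2_end dc.
have nZ : ~ Z (disk_coord (slide2 (d, one))).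
  by move=> [t Ct /= /disk_coord_inj E]; apply: Ct; rewrite E.
pose N := [set d' | ~ Z (disk_coord (slide2 (d', one)))].
have nN : nbhs d N.
  have cs : {for d, continuous (fun d' => disk_coord (slide2 (d', one)))}.
    apply: (@continuous_comp _ _ _ (fun d' => slide2 (d', one)) disk_coord);
      last exact: disk_coord_continuous.
    apply: (@continuous_comp _ _ _ (fun d' => (d', one)) slide2).
      apply: (@continuous_pair_map _ _ _ id (fun=> one)); last exact: cst_continuous.
      by move=> ?; exact: cvg_id.
    exact: slide2_continuous.
  have /(_ (~` Z)) := cs; apply; apply: open_nbhs_nbhs; split=> //.
  exact: closed_openC.
have nc : \forall d' \near d, d' <> disk_center.
  have : open (~` [set (disk_center : disk R)]) by exact/closed_openC/closed_center.
  by rewrite openE; apply.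
suff : nbhs d [set d' | U (attach2 c (slide2 (d', one)))] by [].
apply: filterS2 nN nc => d' Nd' d'c; apply: WU; apply: contrapT => NW.
have /circle_surj[t /andP[t_0 t_1] tE] := slide2_end d'c.
apply: Nd'; exists (clamp t); rewrite /C /= clampK ?t_0 ?ltW // -tE //.
Qed.

Definition from_graph (f : I -> X) :=
  exists2 u : I -> graph, continuous u & homot f (base \o u).

Lemma from_graph_cell (c : cell2 e k) (u : I -> disk R) : continuous u ->
  boundary2 (u zero) -> boundary2 (u one) -> from_graph (cell c \o u).
Proof.
move=> cu /circle_surj[a /andP[a0 a1] aE] /circle_surj[b /andP[b0 b1] bE].
pose l (s : I) : R := (-1 * ival s + 1) * a + ival s * b.
have cl : continuous l.
  apply: continuous_interp; [exact: ival_continuous|exact: cst_continuous..].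
have l0 : l zero = a by rewrite /l ival0; lra.
have l1 : l one = b by rewrite /l ival1; lra.
have lE s : ival (clamp (l s) : I) = l s.
  have s0 := ival_ge0 s; have s1 := ival_le1 s.
  by rewrite clampK // /l; apply/andP; split; nra.
exists (fun s => attach2 c (circle (ival (clamp (l s) : I)))).
  apply: (@continuous_comp_fun _ _ _ (fun t : I => attach2 c (circle (ival t)))).
    exact: boundary_cont.
  exact: continuous_clamp.
rewrite (_ : base \o _ = cell c \o (circle \o l)); last first.
  by apply/funext => s; rewrite /= lE cell_circle_base.
apply: cell_homot => //=; rewrite ?l0 ?l1 //.
by apply: comp_cont => //; exact: circle_continuous.
Qed.

(** One use of [attach_path] moves the path off the disks, where a path between
boundary points can be replaced by an arc of the circle; a second use, inside the
graph, moves it off the edges. *)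
Theorem complex_path_walk (f : I -> X) x y : continuous f ->
  f zero = complex_vertex R e k x -> f one = complex_vertex R e k y ->
  exists s, [/\ path e x s, last x s = y & homot f (base \o walk_path x s)].
Proof.
move=> cf f0 f1.
have [u cu fu] : from_graph f.
  apply: (@attach_path R graph (disk R) (cell2 e k) (@boundary2 R) attach2
    disk_center slide2 closed_boundary2 disk_center_interior closed_center
    slide2_continuous slide2_start slide2_end slide2_fix attach2_slide2_cont
    (circle 0) (circle_boundary 0) _ from_graph _ _ _ from_graph_cell f
    (vertex x) (vertex y) cf f0 f1).
  - move=> d; exists (fun s => to_disk ((-1 * ival s + 1) * (disk_coord (circle 0)).1
        + ival s * (disk_coord d).1,
      (-1 * ival s + 1) * (disk_coord (circle 0)).2 + ival s * (disk_coord d).2)).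
    split.
    + apply: (@continuous_comp_fun _ _ _ (@to_disk R)); first exact: to_disk_continuous.
      by apply: continuous_pair_map; apply: continuous_interp;
        [exact: ival_continuous|exact: cst_continuous|exact: cst_continuous|
         exact: ival_continuous|exact: cst_continuous|exact: cst_continuous].
    + rewrite ival0 !(mulr0, add0r, mul1r, mul0r, addr0).
      by rewrite -surjective_pairing disk_coordK.
    + rewrite ival1 !(mulr1, addNr, mul0r, add0r, mul1r).
      by rewrite -surjective_pairing disk_coordK.
  - move=> g h gh [u cu hu]; exists u => //; exact: homot_trans hu.
  - move=> g h [u cu gu] [v cv hv] gh.
    have uv : u one = v zero.
      apply: (@base_pt_inj _ _ _ (@boundary2 R) attach2).
      have := (homot_ends gu).2; have := (homot_ends hv).1 => /= <- <-.
      by rewrite gh.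
    exists (pcat u v); first exact: pcat_cont.
    by rewrite pcat_comp; exact: homot_pcat.
  - move=> u cu; exists u => //; apply/homot_refl/comp_cont => //.
    exact: base_pt_continuous.
have u0 : u zero = vertex x.
  apply: (@base_pt_inj _ _ _ (@boundary2 R) attach2).
  by have := (homot_ends fu).1; rewrite /= f0.
have u1 : u one = vertex y.
  apply: (@base_pt_inj _ _ _ (@boundary2 R) attach2).
  by have := (homot_ends fu).2; rewrite /= f1.
have [s [ps ls us]] := graph_path_walk e_sym e_irr cu u0 u1.
exists s; split=> //; apply: homot_trans fu _.
by apply: homot_comp us; exact: base_pt_continuous.
Qed.

End two_cells.

(** * Short closed walks *)

Section short_closed_walks.
Context {V : finType} {e : rel V} (e_sym : symmetric e) (e_irr : irreflexive e).

(** Homotopy of walks with a given origin, given by its formal properties and by the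
contraction of the recorded cycles. *)
Context (walk_homot : V -> seq V -> seq V -> Prop).
Context (walk_homot_refl : forall x p, path e x p -> walk_homot x p p)
  (walk_homot_sym : forall x p q, walk_homot x p q -> walk_homot x q p)
  (walk_homot_trans : forall x p q r, walk_homot x p q -> walk_homot x q r -> walk_homot x p r)
  (walk_homot_cat : forall x p p' q q',
     path e x p -> path e x p' -> last x p' = last x p ->
     path e (last x p) q -> path e (last x p) q' ->
     walk_homot x p p' -> walk_homot (last x p) q q' -> walk_homot x (p ++ q) (p' ++ q'))
  (walk_homot_back : forall x p, path e x p -> walk_homot x (p ++ back x p) [::])
  (walk_homot_cell : forall x s, (3 <= size (x :: s) <= 5)%N -> uniq (x :: s) ->
     cycle e (x :: s) -> all (fun y => enum_rank x < enum_rank y)%N s ->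
     (enum_rank (head x s) < enum_rank (last x s))%N ->
     walk_homot x (rcons s x) [::]).

(** Null-homotopic closed walks can be removed from the middle of a walk. *)
Lemma walk_homot_insert x p q r : path e x (p ++ q ++ r) ->
  last (last x p) q = last x p -> walk_homot (last x p) q [::] ->
  walk_homot x (p ++ q ++ r) (p ++ r).
Proof.
rewrite !cat_path => /and3P[pp pq pr] lq hq; rewrite lq in pr.
have pqr : path e (last x p) (q ++ r) by rewrite cat_path pq lq.
have hqr : walk_homot (last x p) (q ++ r) r.
  by apply: (@walk_homot_cat _ q [::] r r); rewrite ?lq //; exact: walk_homot_refl.
by apply: walk_homot_cat => //; exact: walk_homot_refl.
Qed.

Lemma walk_homot_rot x p q : path e x (p ++ q) -> last (last x p) q = x ->
  walk_homot (last x p) (q ++ p) [::] -> walk_homot x (p ++ q) [::].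
Proof.
move=> ppq lq hqp; have := ppq; rewrite cat_path => /andP[pp pq].
have pb := path_back e_sym pp; have lpq : last x (p ++ q) = x by rewrite last_cat.
have pE : p ++ (q ++ p) ++ back x p = (p ++ q) ++ p ++ back x p by rewrite -!catA.
apply: (@walk_homot_trans _ _ (p ++ (q ++ p) ++ back x p)).
  (* the closed walk q p is conjugated by p *)
  rewrite pE -[X in walk_homot _ X]cats0; apply: walk_homot_cat; rewrite ?lpq //.
  - by rewrite cat_path pp.
  - exact: walk_homot_refl.
  - by apply: walk_homot_sym; exact: walk_homot_back.
apply: (@walk_homot_trans _ _ (p ++ back x p)); last exact: walk_homot_back.
apply: walk_homot_insert => //; last by rewrite last_cat lq.
by rewrite pE cat_path ppq lpq cat_path pp.
Qed.

Lemma walk_homot_closed_back x p : path e x p -> last x p = x ->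
  walk_homot x (back x p) [::] -> walk_homot x p [::].
Proof.
move=> pp lp hb; have pb := path_back e_sym pp; rewrite lp in pb.
apply: walk_homot_trans (walk_homot_back pp); apply: walk_homot_sym.
rewrite -[X in walk_homot _ _ X]cats0; apply: walk_homot_cat; rewrite ?lp //.
exact: walk_homot_refl.
Qed.

(** A simple cycle is recorded by its least vertex and the direction of the lesser of
the two neighbours of that vertex; other roots and directions are reached by
conjugation and by reversal. *)
Lemma walk_homot_uniq_cycle x s : (3 <= size (x :: s) <= 5)%N -> uniq (x :: s) ->
  cycle e (x :: s) -> walk_homot x (rcons s x) [::].
Proof.
move=> sz us cs.
have [m ml mmin] : exists2 m, m \in x :: s &
    forall y, y \in x :: s -> (enum_rank m <= enum_rank y)%N.
  have xx : x \in x :: s by rewrite mem_head.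
  exists [arg min_(m < x in x :: s) (enum_rank m : nat)]; first by case: arg_minnP.
  by case: arg_minnP.
have based s' : (3 <= size (m :: s') <= 5)%N -> uniq (m :: s') ->
    cycle e (m :: s') -> {subset s' <= x :: s} -> walk_homot m (rcons s' m) [::].
  move=> sz' us' cs' ss'.
  have mall t : {subset t <= s'} -> all (fun y => enum_rank m < enum_rank y)%N t.
    move=> ts; apply/allP => y /ts ys; rewrite ltn_neqAle mmin ?ss' // andbT.
    apply: contraTneq ys => /val_inj/enum_rank_inj <-.
    by case/andP: us'.
  have [lt_hl|le_lh] := ltnP (enum_rank (head m s')) (enum_rank (last m s')).
    by apply: walk_homot_cell => //; exact: mall.
  have ps' : path e m (rcons s' m) by [].
  apply: walk_homot_closed_back => //; first by rewrite last_rcons.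
  rewrite /back belast_rcons rev_cons; apply: walk_homot_cell.
  - by rewrite /= size_rev.
  - by rewrite /= mem_rev rev_uniq.
  - rewrite /= -rev_cons -(belast_rcons m s' m) -[X in path _ X](last_rcons m s' m).
    exact: path_back.
  - by apply: mall => y; rewrite mem_rev.
  - have -> : head m (rev s') = last m s' by case/lastP: (s') => // t y; rewrite rev_rcons last_rcons.
    have -> : last m (rev s') = head m s' by case: (s') => // y t; rewrite rev_cons last_rcons.
    rewrite ltn_neqAle le_lh andbT.
    apply/negP => /eqP/val_inj/enum_rank_inj.
    case: s' sz' us' {cs' ss' mall le_lh ps'} => [|y [|z t]] //= _.
    by move=> /and3P[_ + _] E; rewrite -E mem_last.
move: ml; rewrite inE => /predU1P[mx|ms].
  by rewrite -mx; apply: based; rewrite ?mx // => y ys; rewrite inE ys orbT.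
case/splitPr: ms us sz cs based => a b us sz cs based.
have E : rcons (a ++ m :: b) x = rcons a m ++ rcons b x by rewrite cat_rcons rcons_cat.
rewrite E; apply: walk_homot_rot.
- by rewrite -E.
- by rewrite last_rcons.
rewrite last_rcons -rcons_cat cat_rcons.
apply: based.
- by move: sz; rewrite /= !size_cat /=; lia.
- have <- : rot (size (x :: a)) (x :: a ++ m :: b) = m :: b ++ x :: a.
    by rewrite -cat_cons rot_size_cat.
  by rewrite rot_uniq.
- have <- : rot (size (x :: a)) (x :: a ++ m :: b) = m :: b ++ x :: a.
    by rewrite -cat_cons rot_size_cat.
  by rewrite rot_cycle.
- by move=> y; rewrite !(mem_cat, inE); case: (y \in a); case: (y == x); case: (y \in b); rewrite ?orbT.
Qed.

Lemma walk_homot_excursion x y : e x y -> walk_homot x [:: y; x] [::].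
Proof. by move=> exy; apply: (@walk_homot_back x [:: y]); rewrite /= exy. Qed.

Lemma walk_homot_triangle x y z : e x y -> e y z -> e z x ->
  walk_homot x [:: y; z; x] [::].
Proof.
move=> exy eyz ezx; apply: (@walk_homot_uniq_cycle x [:: y; z]) => //=.
- have ne a b : e a b -> a != b by apply: contraTneq => ->; rewrite e_irr.
  by rewrite !inE negb_or (ne _ _ exy) (ne _ _ eyz) eq_sym (ne _ _ ezx).
- by rewrite exy eyz ezx.
Qed.

(** A nonempty closed walk of length at most 5 is a simple cycle, an excursion along an edge, or
contains an excursion or a triangle whose removal leaves one of these two. *)
Lemma walk_homot_closed x p : path e x p -> last x p = x -> (size p <= 5)%N ->
  walk_homot x p [::].
Proof.
have ne a b : e a b -> (a == b) = false.
  by move=> eab; apply/negbTE; apply: contraTneq eab => ->; rewrite e_irr.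
have ne' a b : e a b -> (b == a) = false by rewrite eq_sym; exact: ne.
case/lastP: p => [|p z]; first by move=> _ _ _; exact: walk_homot_refl.
rewrite last_rcons size_rcons => + zx sp; rewrite zx => {zx} pp.
have [uxp|] := boolP (uniq (x :: p)).
  case: p pp sp uxp => [|y [|z' p]] pp sp uxp.
  - by move: pp; rewrite /= e_irr.
  - by apply: walk_homot_excursion; case/andP: pp.
  - by apply: walk_homot_uniq_cycle.
case: p pp sp => [|a [|b [|c [|d [|? ?]]]]] //= pp _.
- by move: pp; rewrite inE => /and3P[xa _ _]; rewrite ne.
- case/and4P: pp => xa ab bx _.
  by rewrite !inE (ne _ _ xa) (ne' _ _ bx) (ne _ _ ab).
- case/and5P: pp => xa ab bc cx _.
  rewrite !inE (ne _ _ xa) (ne' _ _ cx) (ne _ _ ab) (ne _ _ bc) /= orbF !andbT.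
  rewrite negb_and !negbK => /orP[/eqP xb|/eqP ac].
    rewrite -xb in ab bc *; apply: walk_homot_trans (walk_homot_excursion bc).
    by apply: (@walk_homot_insert x [::] [:: a; x] [:: c; x]) => //=; rewrite ?xa ?ab ?bc ?cx //; exact: walk_homot_excursion.
  rewrite -ac in bc cx *; apply: walk_homot_trans (walk_homot_excursion xa).
  by apply: (@walk_homot_insert x [:: a] [:: b; a] [:: x]) => //=; rewrite ?xa ?ab ?bc ?cx //; exact: walk_homot_excursion.
case/and5P: pp => xa ab bc cd /andP[dx _].
rewrite !inE (ne _ _ xa) (ne' _ _ dx) (ne _ _ ab) (ne _ _ bc) (ne _ _ cd) /= orbF !andbT.
have [xb _|_] := eqVneq x b.
  rewrite -xb in ab bc *; apply: walk_homot_trans (walk_homot_triangle bc cd dx).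
  by apply: (@walk_homot_insert x [::] [:: a; x] [:: c; d; x]) => //=; rewrite ?xa ?ab ?bc ?cd ?dx //; exact: walk_homot_excursion.
have [xc _|_] := eqVneq x c.
  rewrite -xc in cd bc *; apply: walk_homot_trans (walk_homot_triangle xa ab bc).
  by apply: (@walk_homot_insert x [:: a; b; x] [:: d; x] [::]) => //=; rewrite ?xa ?ab ?bc ?cd ?dx //; exact: walk_homot_excursion.
have [ac _|_] := eqVneq a c.
  rewrite -ac in cd bc *; apply: walk_homot_trans (walk_homot_triangle xa cd dx).
  by apply: (@walk_homot_insert x [:: a] [:: b; a] [:: d; x]) => //=; rewrite ?xa ?ab ?bc ?cd ?dx //; exact: walk_homot_excursion.
have [ad _|_] := eqVneq a d.
  rewrite -ad in cd dx *; apply: walk_homot_trans (walk_homot_excursion xa).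
  by apply: (@walk_homot_insert x [:: a] [:: b; c; a] [:: x]) => //=; rewrite ?xa ?ab ?bc ?cd ?dx //; exact: walk_homot_triangle.
rewrite /= negbK => /eqP bd.
rewrite -bd in cd dx *; apply: walk_homot_trans (walk_homot_triangle xa ab dx).
by apply: (@walk_homot_insert x [:: a; b] [:: c; b] [:: x]) => //=; rewrite ?xa ?ab ?bc ?cd ?dx //; exact: walk_homot_excursion.
Qed.

Lemma walk_homot_short x p q : path e x p -> path e x q -> last x p = last x q ->
  (size p + size q <= 5)%N -> walk_homot x p q.
Proof.
move=> pp pq lpq sz.
have pb := path_back e_sym pq.
have pbq : path e x (p ++ back x q) by rewrite cat_path pp lpq.
apply: (@walk_homot_trans _ _ (p ++ back x q ++ q)).
  apply: walk_homot_sym; rewrite -[X in walk_homot _ _ X]cats0; apply: walk_homot_cat => //.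
  - by rewrite lpq cat_path pb last_back.
  - exact: walk_homot_refl.
  by have := walk_homot_back pb; rewrite backK lpq.
rewrite catA -[X in walk_homot _ _ X]/([::] ++ q); apply: walk_homot_cat => //.
- by rewrite last_cat lpq last_back.
- by rewrite last_cat lpq last_back.
- by rewrite last_cat lpq last_back.
- apply: walk_homot_closed => //; first by rewrite last_cat lpq last_back.
  by rewrite size_cat /back size_rev size_belast.
by rewrite last_cat lpq last_back; exact: walk_homot_refl.
Qed.

End short_closed_walks.

(** * Lin-Lu-Yau curvature and test functions *)

Section curvature_bound.
Context {R : realType} {V : finType} {e : rel V}.
Context (e_sym : symmetric e) (e_irr : irreflexive e)
  (e_conn : forall x y : V, connect e x y).

Lemma has_walkP x y n : reflect
  (exists p, [/\ path e x p, last x p = y & size p = n]) (has_walk e x y n).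
Proof.
apply: (iffP existsP) => [[p /andP[pp /eqP lp]]|[p [pp lp sp]]].
  by exists p; rewrite size_tuple.
have sz : size p == n by apply/eqP.
by exists (Tuple sz); rewrite /= pp lp eqxx.
Qed.

Lemma gdist_find x y : has_walk e x y (gdist e x y).
Proof.
have h : has (has_walk e x y) (iota 0 #|V|).
  have /connectP[p pp ->] := e_conn x y.
  case/shortenP: pp => q pq uq _; apply/hasP; exists (size q).
    rewrite mem_iota /= add0n; have := max_card [in x :: q].
    by rewrite (card_uniqP uq).
  by apply/has_walkP; exists q.
have := nth_find 0%N h; rewrite nth_iota ?add0n //.
by rewrite has_find size_iota in h.
Qed.

Lemma gdist_walk x y : exists p,
  [/\ path e x p, last x p = y & size p = gdist e x y].
Proof. by apply/has_walkP; exact: gdist_find. Qed.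

Lemma gdist_edge x y : e x y -> gdist e x y = 1%N.
Proof.
move=> exy; have xy : x != y by apply: contraTneq exy => ->; rewrite e_irr.
have V2 : (1 < #|V|)%N.
  have := max_card [in [:: x; y]]; rewrite (card_uniqP _) //=.
  by rewrite inE xy.
apply/eqP; rewrite eqn_leq; apply/andP; split.
  rewrite leqNgt; apply/negP => lt1.
  have := before_find 0%N lt1; rewrite nth_iota // add0n => /negbT/negP; apply.
  by apply/has_walkP; exists [:: y]; rewrite /= exy.
rewrite lt0n; apply/eqP => d0; have [p [_ lp sp]] := gdist_walk x y.
by move: sp lp xy; rewrite d0 => /size0nil -> /= ->; rewrite eqxx.
Qed.

Lemma degree_gt0 x y : e x y -> (0 < degree e x)%N.
Proof. by move=> exy; apply/card_gt0P; exists y. Qed.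

Lemma lazy_measure_sum (a : R) x y (f : V -> R) : e x y ->
  \sum_u lazy_measure e a x u * f u =
  f x + (1 - a) * ((\sum_(u | e x u) (f u - f x)) / (degree e x)%:R).
Proof.
move=> exy; have d0 : (degree e x)%:R != 0 :> R.
  by rewrite pnatr_eq0 -lt0n (degree_gt0 exy).
rewrite (bigD1 x) //= {1}/lazy_measure eqxx.
rewrite (eq_bigr (fun u => if e x u then (1 - a) / (degree e x)%:R * f u else 0)); last first.
  by move=> u ux; rewrite /lazy_measure (negbTE ux); case: ifP => //; rewrite mul0r.
rewrite -big_mkcondr /= (eq_bigl (fun u => e x u)); last first.
  by move=> u; case: eqVneq => // ->; rewrite e_irr.
rewrite -mulr_sumr sumrB sumr_const -[#|_|]/(degree e x) -mulr_natl.
by field.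
Qed.

Lemma lazy_measure_ge0 (a : R) x u : 0 <= a <= 1 -> 0 <= lazy_measure e a x u.
Proof.
move=> /andP[a0 a1]; rewrite /lazy_measure; case: ifP => // _; case: ifP => // _.
by rewrite divr_ge0 ?subr_ge0.
Qed.

Lemma lazy_measure_sum1 (a : R) x y : e x y -> \sum_u lazy_measure e a x u = 1.
Proof.
move=> exy; rewrite -[RHS](_ : 1 + (1 - a) *
   ((\sum_(u | e x u) (1 - 1)) / (degree e x)%:R) = 1); last first.
  by rewrite big1 ?mul0r ?mulr0 ?addr0 // => u _; rewrite subrr.
by rewrite -(lazy_measure_sum a (fun=> 1) exy); apply: eq_bigr => u _; rewrite mulr1.
Qed.

(** The easy half of Kantorovich duality.  Two test functions are allowed, and the
Lipschitz condition is only imposed between the supports: this is what makes the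
curvature of an edge a local quantity. *)
Lemma W1_ge (mu nu : V -> R) (f g : V -> R) :
  (forall u, 0 <= mu u) -> (forall v, 0 <= nu v) ->
  \sum_u mu u = 1 -> \sum_v nu v = 1 ->
  (forall u v, mu u != 0 -> nu v != 0 -> g v - f u <= (gdist e u v)%:R) ->
  \sum_v nu v * g v - \sum_u mu u * f u <= W1 e mu nu.
Proof.
move=> mu0 nu0 mu1 nu1 fg; apply: lb_le_inf.
  exists (\sum_u \sum_v (gdist e u v)%:R * (mu u * nu v)), (fun u v => mu u * nu v) => //.
  split=> [u v|u|v]; first exact: mulr_ge0.
    by rewrite -mulr_sumr nu1 mulr1.
  by rewrite -mulr_suml mu1 mul1r.
move=> _ [c [c0 cu cv] ->].
have -> : \sum_v nu v * g v - \sum_u mu u * f u =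
    \sum_u \sum_v (g v - f u) * c u v.
  under [RHS]eq_bigr do (under eq_bigr do rewrite mulrBl; rewrite sumrB).
  rewrite sumrB exchange_big /=; congr (_ - _).
    by apply: eq_bigr => v _; rewrite -cv mulrC mulr_sumr.
  by apply: eq_bigr => u _; rewrite -cu mulrC mulr_sumr.
apply: ler_sum => u _; apply: ler_sum => v _.
have [cuv|cuv] := eqVneq (c u v) 0; first by rewrite cuv !mulr0.
apply: ler_wpM2r => //; apply: fg.
  apply: contra_neq cuv => mu_u; move: (cu u); rewrite mu_u.
  by move/eqP; rewrite psumr_eq0 // => /allP/(_ v); rewrite mem_index_enum => /(_ isT)/eqP.
apply: contra_neq cuv => nu_v; move: (cv v); rewrite nu_v.
by move/eqP; rewrite psumr_eq0 // => /allP/(_ u); rewrite mem_index_enum => /(_ isT)/eqP.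
Qed.

(** For each a < 1 the quotient is at most the difference of the Laplacians, by
[W1_ge].  The limit exists, for otherwise its default value 0 would contradict
positivity. *)
Lemma kappa_le x y (f g : V -> R) : e x y ->
  (forall u v, u = x \/ e x u -> v = y \/ e y v ->
     g v - f u <= (gdist e u v)%:R) ->
  g y - f x = 1 -> 0 < kappa R e x y ->
  kappa R e x y <= (\sum_(u | e x u) (f u - f x)) / (degree e x)%:R
       - (\sum_(v | e y v) (g v - g y)) / (degree e y)%:R.
Proof.
move=> exy fg gfy k0; have eyx : e y x by rewrite e_sym.
set B := (X in _ <= X).
have lazyB (a : R) : 0 <= a < 1 -> kappa_lazy e a x y / (1 - a) <= B.
  move=> /andP[a0 a1]; rewrite ler_pdivrMr; last by lra.
  have a01 : 0 <= a <= 1 by rewrite a0 ltW.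
  have supp z w : lazy_measure e a z w != 0 -> w = z \/ e z w.
    rewrite /lazy_measure; have [wz|_] := eqVneq w z; first by left.
    by case: ifP => [|_]; [right|rewrite eqxx].
  have := @W1_ge (lazy_measure e a x) (lazy_measure e a y) f g.
  rewrite (lazy_measure_sum a _ exy) (lazy_measure_sum a _ eyx).
  move=> /(_ _ _ (lazy_measure_sum1 a exy) (lazy_measure_sum1 a eyx)) WB.
  have {}WB := WB (fun u => lazy_measure_ge0 x u a01)
    (fun u => lazy_measure_ge0 y u a01)
    (fun u v hu hv => fg u v (supp _ _ hu) (supp _ _ hv)).
  by rewrite /kappa_lazy gdist_edge // divr1 /B; lra.
have cvk : cvg (kappa_lazy e a x y / (1 - a) @[a --> (1 : R)^'-]).
  apply: contrapT => ncv; have kE := dvgP ncv; move: k0; rewrite /kappa kE.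
  by rewrite ltxx.
apply: limr_le => //; near=> a; apply: lazyB; apply/andP; split.
  by near: a; apply: nbhs_left_ge.
by near: a; exact: nbhs_left_lt.
Unshelve. all: by end_near. Qed.

(** A set of reals without a lower bound has infimum 0 by convention, so positivity
of the infimum makes it an actual lower bound. *)
Lemma kappa_min_le x y : 0 < kappa_min R e -> e x y ->
  kappa_min R e <= kappa R e x y.
Proof.
move=> k0 exy; rewrite /kappa_min in k0 *; apply: ge_inf; last by exists x, y.
apply: contrapT => nlb; move: k0; rewrite inf_out ?ltxx // => -[_ //].
Qed.

Lemma kappa_min_bound x y (f g : V -> R) : 0 < kappa_min R e -> e x y ->
  (forall u v, u = x \/ e x u -> v = y \/ e y v ->
     g v - f u <= (gdist e u v)%:R) ->
  g y - f x = 1 ->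
  kappa_min R e <= (\sum_(u | e x u) (f u - f x)) / (degree e x)%:R
       - (\sum_(v | e y v) (g v - g y)) / (degree e y)%:R.
Proof.
move=> k0 exy fg gfy; have kxy := kappa_min_le k0 exy.
have kxy0 := lt_le_trans k0 kxy; apply: (le_trans kxy).
exact: kappa_le.
Qed.

End curvature_bound.

(** * Distances in the universal cover *)

Section universal_cover.
Local Open Scope nat_scope.
Context {R : realType} {V : finType} {e : rel V}.
Context (e_sym : symmetric e) (e_irr : irreflexive e).
(** Walks from o related by [eqv] are those with the same end in the cover; through
[eqv_short], closed walks of length at most 5 lift to closed walks. *)
Context (o : V) (eqv : seq V -> seq V -> Prop).
Context (eqv_refl : forall s, path e o s -> eqv s s)
  (eqv_sym : forall s t, eqv s t -> eqv t s)
  (eqv_trans : forall s t u, eqv s t -> eqv t u -> eqv s u)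
  (eqv_path : forall s t, eqv s t -> path e o s)
  (eqv_rcons : forall s t x, eqv s t -> e (last o s) x ->
     eqv (rcons s x) (rcons t x))
  (eqv_short : forall s p q, path e o (s ++ p) -> path e o (s ++ q) ->
     last (last o s) p = last (last o s) q -> (size p + size q <= 5)%N ->
     eqv (s ++ p) (s ++ q)).

Definition depth_spec s (n : nat) : bool :=
  `[< exists t, eqv s t /\ size t = n >].

(** The distance in the cover from the vertex represented by [s] to the one
represented by the empty walk; it is 0 when [s] is not a walk from [o]. *)
Definition depth s : nat :=
  if pselect (exists n, depth_spec s n) is left h then ex_minn h else 0.

Lemma eqv_path2 s t : eqv s t -> path e o t.
Proof. by move/eqv_sym/eqv_path. Qed.

Lemma depthP s : path e o s ->
  (exists t, eqv s t /\ size t = depth s) /\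
  (forall t, eqv s t -> (depth s <= size t)%N).
Proof.
move=> ps; rewrite /depth; case: pselect => [h|[]]; last first.
  by exists (size s); apply/asboolP; exists s; split=> //; exact: eqv_refl.
case: ex_minnP => n /asboolP nP nmin; split=> // t st.
by apply: nmin; apply/asboolP; exists t.
Qed.

Lemma depth_le s t : eqv s t -> (depth s <= size t)%N.
Proof. by move=> st; have [_] := depthP (eqv_path st); apply. Qed.

Lemma depth_le_size s : path e o s -> (depth s <= size s)%N.
Proof. by move=> ps; apply: depth_le; exact: eqv_refl. Qed.

Lemma depth_eqv_le s t : eqv s t -> (depth s <= depth t)%N.
Proof.
move=> st; have [[u [tu <-]] _] := depthP (eqv_path2 st).
exact/depth_le/(eqv_trans st).
Qed.

Lemma depth_eqv s t : eqv s t -> depth s = depth t.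
Proof.
by move=> st; apply/eqP; rewrite eqn_leq !depth_eqv_le //; exact: eqv_sym.
Qed.

Lemma depth_rcons_le s x : path e o (rcons s x) ->
  (depth (rcons s x) <= (depth s).+1)%N.
Proof.
rewrite rcons_path => /andP[ps ex]; have [[t [st <-]] _] := depthP ps.
by rewrite -(size_rcons t x); apply/depth_le/eqv_rcons.
Qed.

Lemma eqv_backtrack s x : path e o (rcons s x) ->
  eqv (rcons (rcons s x) (last o s)) s.
Proof.
rewrite rcons_path => /andP[ps ex].
rewrite -cats1 -cats1 -catA -[X in eqv _ X]cats0; apply: eqv_short => //.
  by rewrite cat_path ps /= ex e_sym ex.
by rewrite cats0.
Qed.

(** Going back along the last edge cancels it. *)
Lemma depth_rcons_ge s x : path e o (rcons s x) ->
  (depth s <= (depth (rcons s x)).+1)%N.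
Proof.
move=> psx; rewrite -(depth_eqv (eqv_backtrack psx)).
apply: depth_rcons_le; rewrite rcons_path psx last_rcons /=.
by move: psx; rewrite rcons_path e_sym => /andP[].
Qed.

Lemma depth_cat_le s p : path e o (s ++ p) ->
  (depth (s ++ p) <= depth s + size p)%N.
Proof.
elim/last_ind: p => [|p x IHp]; first by rewrite cats0 addn0.
rewrite -rcons_cat => psp; apply: leq_trans (depth_rcons_le psp) _.
rewrite size_rcons addnS ltnS IHp //.
by move: psp; rewrite rcons_path => /andP[].
Qed.

Definition geodesic s := path e o s && (depth s == size s).

Lemma geodesic_rcons s x : geodesic (rcons s x) -> geodesic s.
Proof.
rewrite /geodesic => /andP[psx]; rewrite size_rcons => /eqP dsx.
have := psx; rewrite rcons_path => /andP[ps _]; rewrite ps eqn_leq.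
by rewrite depth_le_size //= -ltnS -dsx depth_rcons_le.
Qed.

(** The neighbours of the end of [s] other than its last vertex but one.  For the
empty walk, the excluded vertex is [o], which is not a neighbour of itself. *)
Definition ahead s : seq V :=
  [seq y <- enum V | e (last o s) y && (y != last o (belast o s))].

Fixpoint nonbacktracking_walks (n : nat) : seq (seq V) :=
  if n is n'.+1 then [seq rcons s y | s <- nonbacktracking_walks n', y <- ahead s]
  else [:: [::]].

Lemma nonbacktracking_walks_path n s : s \in nonbacktracking_walks n -> path e o s /\ size s = n.
Proof.
elim: n s => [|n IHn] s /=; first by rewrite inE => /eqP ->.
case/allpairsPdep => t [y [tn + ->]]; have [pt st] := IHn t tn.
rewrite mem_filter => /andP[/andP[ey _] _].
by rewrite rcons_path pt ey size_rcons st.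
Qed.

Lemma degree_le_max x : degree e x <= max_degree e.
Proof. exact: leq_bigmax. Qed.

Lemma size_aheadE s : size (ahead s) =
  #|[pred y | e (last o s) y && (y != last o (belast o s))]|.
Proof. by rewrite cardE /enum_mem -enumT; congr size; apply: eq_filter. Qed.

Lemma size_ahead0 : (size (ahead [::]) <= max_degree e)%N.
Proof.
rewrite size_aheadE (leq_trans _ (degree_le_max o)) // /degree.
by apply/subset_leq_card/fintype.subsetP => y; rewrite !inE => /andP[].
Qed.

Lemma size_ahead s x : path e o (rcons s x) ->
  (size (ahead (rcons s x)) <= max_degree e - 1)%N.
Proof.
rewrite rcons_path size_aheadE last_rcons belast_rcons /= => /andP[ps ex].
rewrite -ltnS subn1 (@leq_trans (degree e x)) //; last first.
  by rewrite (leq_trans (degree_le_max x)) // leqSpred.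
rewrite /degree (cardD1 (last o s) [pred y | e x y]) inE e_sym ex add1n ltnS.
by apply/subset_leq_card/fintype.subsetP => y; rewrite !inE => /andP[-> ->].
Qed.

Lemma size_allpairs_le (A B : eqType) (f : A -> B -> seq V) (a : seq A)
    (b : A -> seq B) m : (forall x, x \in a -> (size (b x) <= m)%N) ->
  (size [seq f x y | x <- a, y <- b x] <= size a * m)%N.
Proof.
elim: a => //= x a IHa bm; rewrite size_cat size_map mulSn leq_add //.
  by apply: bm; rewrite mem_head.
by apply: IHa => y ya; apply: bm; rewrite inE ya orbT.
Qed.

Lemma size_nonbacktracking_walks n : (size (nonbacktracking_walks n.+1) <= max_degree e * (max_degree e - 1) ^ n)%N.
Proof.
elim: n => [|n IHn]; first by rewrite expn0 muln1 /= cats0 size_map size_ahead0.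
apply: (@leq_trans (size (nonbacktracking_walks n.+1) * (max_degree e - 1))).
  apply: size_allpairs_le => s sn; have [] := @nonbacktracking_walks_path n.+1 s sn.
  by case/lastP: s {sn} => // s x psx _; exact: size_ahead.
by rewrite expnSr mulnA leq_mul2r IHn orbT.
Qed.

(** A backtracking could be cancelled, which would shorten the walk. *)
Lemma geodesic_nonbacktracking s : geodesic s -> s \in nonbacktracking_walks (size s).
Proof.
elim/last_ind: s => [|s y IHs] //= gsy; have /IHs sn := geodesic_rcons gsy.
rewrite size_rcons; apply/allpairsPdep; exists s, y; split=> //.
case/andP: gsy; rewrite rcons_path => /andP[ps ey] /eqP dsy.
rewrite mem_filter ey mem_enum andbT /=.
case/lastP: s {IHs sn} => [|s x] in ps ey dsy *.
  by apply: contraTneq ey => /= ->; rewrite e_irr.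
rewrite belast_rcons /=; apply/eqP => yE; move: dsy; rewrite yE.
rewrite (depth_eqv (eqv_backtrack ps)) => ds.
have := depth_le_size (_ : path e o s); rewrite ds !size_rcons => /(_ _).
have ps' : path e o s by move: ps; rewrite rcons_path => /andP[].
by move/(_ ps'); rewrite ltnNge leqnSn.
Qed.

Definition short_nonbacktracking_walks (r : nat) : seq (seq V) :=
  flatten [seq nonbacktracking_walks n | n <- iota 0 r.+1].

(** The Moore bound: at most Delta choices for the first step of a walk and
Delta - 1 for each later one. *)
Lemma size_short_nonbacktracking_walks r :
  (size (short_nonbacktracking_walks r) <= 1 + max_degree e * \sum_(j < r) (max_degree e - 1) ^ j)%N.
Proof.
rewrite /short_nonbacktracking_walks; elim: r => [|r IHr]; first by rewrite big_ord0.
rewrite -addn1 iotaD map_cat flatten_cat size_cat big_ord_recr /= mulnDr addnA.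
by rewrite leq_add // cats0; exact: size_nonbacktracking_walks.
Qed.

Local Open Scope ring_scope.
Local Notation k := (kappa_min R e).
Context (e_conn : forall x y : V, connect e x y) (k_gt0 : 0 < k).

(** The normalised Laplacian of the distance function, at the vertex of the cover
represented by [s]. *)
Definition laplacian s : R :=
  (\sum_(u | e (last o s) u) ((depth (rcons s u))%:R - (depth s)%:R))
    / (degree e (last o s))%:R.

Lemma laplacian_bound s : path e o s -> -1 <= laplacian s <= 1.
Proof.
move=> ps; rewrite -ler_norml /laplacian normrM normfV.
have [d0|d0] := eqVneq (degree e (last o s)) 0%N.
  by rewrite d0 normr0 invr0 mulr0.
rewrite ler_pdivrMr ?normr_gt0 ?pnatr_eq0 // mul1r normr_nat.
apply: le_trans (ler_norm_sum _ _ _) _.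
apply: (@le_trans _ _ (\sum_(u | e (last o s) u) 1)); last first.
  by rewrite sumr_const.
apply: ler_sum => u eu.
have psu : path e o (rcons s u) by rewrite rcons_path ps.
have := depth_rcons_le psu; have := depth_rcons_ge psu.
rewrite -(ler_nat R) -(ler_nat R (depth (rcons s u))) -!natr1 ler_norml.
by move=> h1 h2; apply/andP; split; lra.
Qed.

(** The lower curvature bound passes to the cover.  The test functions on G are read
off around the two ends of the lifted edge.  If u and v are at distance at most 2,
the walks to v through y and through u close up to a walk of length at most 5, so
they end at the same vertex of the cover; at distance at least 3, the triangle
inequality in the cover suffices. *)
Lemma laplacian_drop s y : path e o (rcons s y) ->
  depth (rcons s y) = (depth s).+1 ->
  k <= laplacian s - laplacian (rcons s y).
Proof.
move=> psy dsy; have := psy; rewrite rcons_path => /andP[ps ey].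
set x := last o s in ey *.
pose f u : R := (if u == x then depth s else depth (rcons s u))%:R.
pose g v : R := (if v == y then depth (rcons s y) else depth (rcons (rcons s y) v))%:R.
have fx : f x = (depth s)%:R by rewrite /f eqxx.
have gy : g y = (depth s).+1%:R by rewrite /g eqxx dsy.
have fE u : e x u -> f u = (depth (rcons s u))%:R.
  by rewrite /f; case: eqP => [->|//]; rewrite e_irr.
have gE v : e y v -> g v = (depth (rcons (rcons s y) v))%:R.
  by rewrite /g; case: eqP => [->|//]; rewrite e_irr.
suff fg u v : u = x \/ e x u -> v = y \/ e y v -> g v - f u <= (gdist e u v)%:R.
  have gfy : g y - f x = 1 by rewrite gy fx -natr1; lra.
  apply: le_trans (kappa_min_bound e_sym e_irr e_conn k_gt0 ey fg gfy) _.
  rewrite gy fx.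
  rewrite le_eqVlt; apply/orP; left; apply/eqP; congr (_ - _); congr (_ / _).
  - by apply: eq_bigr => u /fE ->.
  - rewrite last_rcons; apply: eq_bigr => v /gE ->.
    by rewrite dsy -natr1.
  - by rewrite last_rcons.
move=> xu yv; rewrite lerBlDr.
(* u may be x itself, and v may be y *)
pose p := if u == x then [::] else [:: u].
pose q := if v == y then [:: y] else [:: y; v].
have [pp lp] : path e x p /\ last x p = u.
  by rewrite /p; case: eqP => [->|ux] //=; case: xu => // ->.
have [pq lq] : path e x q /\ last x q = v.
  rewrite /q; case: eqP => [->|vy] /=; rewrite ey //=.
  by case: yv => // ->.
have fuE : f u = (depth (s ++ p))%:R.
  by rewrite /f /p; case: eqP => _; rewrite ?cats0 ?cats1.
have gvE : g v = (depth (s ++ q))%:R.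
  by rewrite /g /q; case: eqP => _; rewrite ?cats1 // -[[:: y; v]]cat1s catA !cats1.
have sp : (size p <= 1)%N by rewrite /p; case: ifP.
have sq : (size q <= 2)%N by rewrite /q; case: ifP.
rewrite fuE gvE -natrD ler_nat.
have psp : path e o (s ++ p) by rewrite cat_path ps.
have psq : path e o (s ++ q) by rewrite cat_path ps.
have [far|near] := leqP 3 (gdist e u v).
  have hq : (depth (s ++ q) <= depth s + 2)%N.
    by apply: leq_trans (depth_cat_le psq) _; rewrite leq_add2l.
  have hp : (depth s <= depth (s ++ p) + 1)%N.
    rewrite /p; case: eqP => [_|ux]; first by rewrite cats0 leq_addr.
    rewrite cats1 addn1; apply: depth_rcons_ge.
    by move: psp; rewrite /p (introF eqP ux) cats1.
  by lia.
have [t [pt lt st]] := gdist_walk e_conn u v.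
have pspt : path e o (s ++ (p ++ t)) by rewrite catA cat_path psp last_cat -/x lp.
apply: leq_trans (depth_eqv_le (_ : eqv _ (s ++ (p ++ t)))) _.
  apply: eqv_short => //; first by rewrite -/x lq last_cat lp.
  by rewrite size_cat st; lia.
rewrite catA; apply: leq_trans (depth_cat_le _) _; first by rewrite -catA.
by rewrite st addnC.
Qed.

(** The theorem of Bonnet and Myers: the inequalities of [laplacian_drop] telescope
along the geodesic. *)
Lemma geodesic_size s : geodesic s -> (size s)%:R * k <= 2.
Proof.
move=> gs; have [ps _] := andP gs.
suff : (size s)%:R * k <= laplacian [::] - laplacian s.
  have /andP[_ l1] := @laplacian_bound [::] isT.
  by have /andP[l2 _] := laplacian_bound ps; lra.
elim/last_ind: s gs ps => [|s y IHs] gs ps.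
  by rewrite mul0r subrr.
have gs' := geodesic_rcons gs; have [ps' /eqP ds'] := andP gs'.
have [_ /eqP ds] := andP gs.
have := laplacian_drop ps; rewrite ds ds' size_rcons => /(_ erefl).
by have := IHs gs' ps'; rewrite -natr1 mulrDl mul1r; lra.
Qed.

(** The cover is the ball of radius r around the class of the empty walk. *)
Theorem short_representatives s : path e o s ->
  exists2 t, t \in short_nonbacktracking_walks (Num.truncn (2 / k)) & eqv s t.
Proof.
move=> ps; have [[t [st td]] _] := depthP ps.
have gt : geodesic t.
  by rewrite /geodesic (eqv_path2 st) td (depth_eqv st) eqxx.
exists t; last by [].
apply/flattenP; exists (nonbacktracking_walks (size t)).
  apply: map_f; rewrite mem_iota /= ltnS.
  have q0 : 0 <= 2 / k by rewrite divr_ge0 // ltW.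
  by rewrite (truncn_ge_nat _ q0) ler_pdivlMr // geodesic_size.
exact: geodesic_nonbacktracking.
Qed.

End universal_cover.

(** * The bound on the fundamental group *)

Lemma homot_path_homotopic (R : realType) (X : topologicalType) (x y : X)
    (p q : {path I01 R from x to y}) : homot p q -> path_homotopic p q.
Proof.
move=> [x' [y' [p' [q' [pE qE pq]]]]].
have xE : x' = x by rewrite -(@path_zero _ _ _ _ p') -pE path_zero.
have yE : y' = y by rewrite -(@path_one _ _ _ _ p') -pE path_one.
move: p' q' pE qE pq; rewrite xE yE => p' q' pE qE.
have -> : p' = p by apply/path_eqP => s; rewrite pE.
by have -> : q' = q by apply/path_eqP => s; rewrite qE.
Qed.

Lemma homot_cancelr (R : realType) (X : topologicalType) (f g h : I01 R -> X) :
  continuous f -> continuous g -> continuous h ->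
  f one = h zero -> g one = h zero ->
  homot (pcat f h) (pcat g h) -> homot f g.
Proof.
move=> cf cg ch fh gh fg.
have cb := pback_cont ch.
have cancel k : continuous k -> k one = h zero ->
    homot (pcat (pcat k h) (pback h)) k.
  move=> ck kh; apply: (@homot_trans _ _ (pcat k (pcat h (pback h)))).
    by apply/homot_sym/homot_pcatA => //; rewrite pback0.
  apply: (@homot_trans _ _ (pcat k (fun=> h zero))); last exact: homot_pcatp1.
  by apply: homot_pcat; [exact: homot_refl|exact: homot_pcatpV|rewrite pcat0].
apply: homot_trans (homot_sym (cancel f cf fh)) _.
apply: homot_trans (cancel g cg gh).
by apply: homot_pcat => //; [exact: homot_refl|rewrite pcat1 pback0].
Qed.

Section walks_in_complex.
Context {R : realType} {V : finType} {e : rel V}.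
Context (e_sym : symmetric e) (e_irr : irreflexive e).
Local Notation I := (I01 R).
Local Notation X := (short_cycle_complex R e 5).
Local Notation base := (@base_pt (graph_space R e) (disk R) (cell2 e 5)
  (@boundary2 R) (@attach2 R V e 5)).

Definition complex_walk (x : V) (p : seq V) : I -> X := base \o walk_path x p.

Definition walk_homot (x : V) (p q : seq V) : Prop :=
  homot (complex_walk x p) (complex_walk x q).

Lemma complex_walk_cont x p : path e x p -> continuous (complex_walk x p).
Proof.
move=> pp; apply: comp_cont; first exact: base_pt_continuous.
exact: (walk_path_cont e_sym e_irr pp).
Qed.

Lemma complex_walk0 x p : path e x p ->
  complex_walk x p zero = complex_vertex R e 5 x.
Proof. by move=> pp; rewrite /complex_walk /= (walk_path0 e_sym e_irr pp). Qed.

Lemma complex_walk1 x p :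
  complex_walk x p one = complex_vertex R e 5 (last x p).
Proof. by rewrite /complex_walk /= walk_path1. Qed.

Lemma complex_walk_cat x p q : path e x (p ++ q) ->
  homot (complex_walk x (p ++ q))
        (pcat (complex_walk x p) (complex_walk (last x p) q)).
Proof.
move=> ppq; rewrite /complex_walk -pcat_comp.
apply: homot_comp (walk_path_cat e_sym e_irr ppq).
exact: base_pt_continuous.
Qed.

Lemma walk_homot_refl x p : path e x p -> walk_homot x p p.
Proof. by move=> pp; exact/homot_refl/complex_walk_cont. Qed.

Lemma walk_homot_cat x p p' q q' :
  path e x p -> path e x p' -> last x p' = last x p ->
  path e (last x p) q -> path e (last x p) q' ->
  walk_homot x p p' -> walk_homot (last x p) q q' -> walk_homot x (p ++ q) (p' ++ q').
Proof.
move=> pp pp' lp pq pq' hp hq.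
have ppq : path e x (p ++ q) by rewrite cat_path pp.
have ppq' : path e x (p' ++ q') by rewrite cat_path pp' lp.
apply: homot_trans (complex_walk_cat ppq) _.
apply: homot_trans (homot_sym (complex_walk_cat ppq')); rewrite lp.
by apply: homot_pcat => //; rewrite complex_walk1 complex_walk0.
Qed.

Lemma walk_homot_back x p : path e x p -> walk_homot x (p ++ back x p) [::].
Proof.
move=> pp; have pb := path_back e_sym pp.
have ppb : path e x (p ++ back x p) by rewrite cat_path pp.
apply: homot_trans (complex_walk_cat ppb) _.
rewrite {2}/complex_walk.
apply: (@homot_trans _ _ (pcat (complex_walk x p) (pback (complex_walk x p)))).
  apply: homot_pcat; first exact: walk_homot_refl.
    rewrite /complex_walk -pback_comp.
    apply: homot_comp (walk_path_back e_sym e_irr pp).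
    exact: base_pt_continuous.
  by rewrite complex_walk1 -[RHS]/(complex_walk _ _ zero) complex_walk0.
have -> : complex_walk x [::] = fun=> complex_walk x p zero.
  by apply/funext => t; rewrite complex_walk0.
by apply: homot_pcatpV; exact: complex_walk_cont.
Qed.

Lemma walk_homot_cell x s : (3 <= size (x :: s) <= 5)%N -> uniq (x :: s) ->
  cycle e (x :: s) -> all (fun y => enum_rank x < enum_rank y)%N s ->
  (enum_rank (head x s) < enum_rank (last x s))%N ->
  walk_homot x (rcons s x) [::].
Proof.
move=> sz us cs als hl; have c2 : is_cell2 e 5 (x, s) by apply/and5P.
exact: (@short_cycle_null R V e e_sym e_irr 5 (Sub (x, s) c2)).
Qed.

Lemma complex_walk_short x p q : path e x p -> path e x q ->
  last x p = last x q -> (size p + size q <= 5)%N -> walk_homot x p q.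
Proof.
exact: (walk_homot_short e_sym e_irr walk_homot_refl (fun x p q => @homot_sym _ _ _ _)
  (fun x p q r => @homot_trans _ _ _ _ _) walk_homot_cat walk_homot_back walk_homot_cell).
Qed.

(** Equality of the end points of the lifts of two walks to the cover. *)
Definition same_lift (o : V) (s t : seq V) : Prop :=
  [/\ path e o s, path e o t, last o s = last o t & walk_homot o s t].

Lemma same_lift_refl o s : path e o s -> same_lift o s s.
Proof. by move=> ps; split=> //; exact: walk_homot_refl. Qed.

Lemma same_lift_sym o s t : same_lift o s t -> same_lift o t s.
Proof. by case=> ps pt lst hst; split=> //; exact: homot_sym. Qed.

Lemma same_lift_trans o s t u :
  same_lift o s t -> same_lift o t u -> same_lift o s u.
Proof.
case=> ps pt lst hst [_ pu ltu htu]; split=> //; first by rewrite lst.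
exact: homot_trans htu.
Qed.

Lemma same_lift_path o s t : same_lift o s t -> path e o s.
Proof. by case. Qed.

Lemma same_lift_rcons o s t x : same_lift o s t -> e (last o s) x ->
  same_lift o (rcons s x) (rcons t x).
Proof.
case=> ps pt lst hst ex; split; rewrite ?rcons_path ?last_rcons ?ps ?pt //.
  by rewrite -lst.
rewrite -!cats1; apply: walk_homot_cat => //=; rewrite ?ex //.
by apply: walk_homot_refl => //=; rewrite ex.
Qed.

Lemma same_lift_short o s p q : path e o (s ++ p) -> path e o (s ++ q) ->
  last (last o s) p = last (last o s) q -> (size p + size q <= 5)%N ->
  same_lift o (s ++ p) (s ++ q).
Proof.
move=> psp psq lpq sz; split; rewrite ?last_cat //.
move: psp psq; rewrite !cat_path => /andP[ps pp] /andP[_ pq].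
apply: walk_homot_cat => //; first exact: walk_homot_refl.
exact: complex_walk_short.
Qed.

End walks_in_complex.

Theorem proposition4p6 (R : realType) (V : finType) (e : rel V)
    (e_sym : symmetric e) (e_irr : irreflexive e)
    (e_conn : forall x y : V, connect e x y)
    (e_edge : exists x y : V, e x y)
    (kappa_gt0 : 0 < kappa_min R e) (o : V) :
  let n := #|V| in
  let Delta := max_degree e in
  let r := Num.truncn (2 / kappa_min R e) in
  let G := pi1 R (complex_vertex R e 5 o) in
  finite_set [set: G] /\
  (#|` fset_set [set: G]|%:R : R) <=
    (1 + Delta * \sum_(j < r) (Delta - 1) ^ j)%N%:R / n%:R.
Proof.
move=> n Delta r G.
pose same := @same_lift R V e o.
pose L := short_nonbacktracking_walks (e := e) o r.
have repL s : path e o s -> exists2 t, t \in L & same s t.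
  exact: (short_representatives e_sym e_irr (@same_lift_refl R V e e_sym e_irr o)
    (@same_lift_sym R V e o) (@same_lift_trans R V e o) (@same_lift_path R V e o)
    (@same_lift_rcons R V e e_sym e_irr o) (@same_lift_short R V e e_sym e_irr o)
    e_conn kappa_gt0).
have sizeL : (size L <= 1 + Delta * \sum_(j < r) (Delta - 1) ^ j)%N.
  exact: size_short_nonbacktracking_walks.
have /choice[loop loopP] : forall g : G, exists s,
    [/\ path e o s, last o s = o &
        homot (repr g : {path I01 R from _ to _}) (complex_walk (e := e) o s)].
  move=> g; apply: (complex_path_walk e_sym e_irr).
  - exact: cts_fun.
  - exact: path_zero.
  - exact: path_one.
have /choice[trunk trunkP] : forall v, exists p, path e o p /\ last o p = v.
  by move=> v; have /connectP[p pp lp] := e_conn o v; exists p.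
(* a loop class g and a vertex v determine a vertex of the cover over v *)
have /choice[code codeP] : forall gv : G * V, exists t,
    t \in L /\ same (loop gv.1 ++ trunk gv.2) t.
  move=> [g v]; have [lp ll _] := loopP g; have [tp _] := trunkP v.
  have [|t tL et] := repL (loop g ++ trunk v).
    by rewrite cat_path lp ll.
  by exists t.
have code_inj : injective code.
  move=> [g v] [h w] E.
  have [_ /= eg] := codeP (g, v); have [_ /= eh] := codeP (h, w).
  have [lp ll lh] := loopP g; have [lp' ll' lh'] := loopP h.
  have [tp tl] := trunkP v; have [tp' tl'] := trunkP w.
  rewrite E in eg; have [p1 p2 l12 h12] := same_lift_trans eg (same_lift_sym eh).
  have vw : v = w by move: l12; rewrite !last_cat ll ll' tl tl'.
  congr (_, _) => //; rewrite -{}vw in p2 h12.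
  rewrite -[g]reprK -[h]reprK; apply/pi1_eqP/homot_path_homotopic.
  apply: homot_trans lh _; apply: homot_trans (homot_sym lh').
  apply: (@homot_cancelr _ _ _ _ (complex_walk (R := R) (e := e) o (trunk v))).
  - exact: complex_walk_cont.
  - exact: complex_walk_cont.
  - exact: complex_walk_cont.
  - by rewrite complex_walk1 complex_walk0 // ll.
  - by rewrite complex_walk1 complex_walk0 // ll'.
  have := homot_trans (homot_sym (complex_walk_cat e_sym e_irr p1))
    (homot_trans h12 (complex_walk_cat e_sym e_irr p2)).
  by rewrite ll ll'.
have finG : finite_set [set: G].
  rewrite (_ : [set: G] = (fun g => code (g, o)) @^-1` [set` L]).
    apply: finite_preimage; last exact: finite_seq.
    by move=> g h _ _ /code_inj[].
  by apply/seteqP; split=> // g _ /=; case: (codeP (g, o)).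
split=> //.
have n0 : (0 < n)%N by apply/card_gt0P; exists o.
rewrite ler_pdivlMr ?ltr0n // -natrM ler_nat; apply: leq_trans sizeL.
pose K := fset_set [set: G].
have -> : (#|` K| * n = size [seq code (g, v) | g <- K, v <- enum V])%N.
  by rewrite size_allpairs -cardE.
apply: uniq_leq_size.
  apply: allpairs_uniq; [exact: fset_uniq|exact: enum_uniq|].
  by move=> [g v] [h w] _ _ /code_inj.
by move=> t /allpairsP[[g v] [_ _ ->]]; case: (codeP (g, v)).
Qed.
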